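(* Let $(\phi_t)_{t\ge0}$ be a one-parameter semigroup in $\mathbb{D}$, with each $\phi_t$ extended to $\mathbb{T}$ by its angular limits, $\phi_t(\sigma):=\angle\lim_{z\to\sigma}\phi_t(z)$ for $\sigma\in\mathbb{T}$. Then the family of functions $$\Big([0,+\infty)\ni t\mapsto\phi_t(z)\Big)_{z\in\overline{\mathbb{D}}}$$ is uniformly equicontinuous.
   Context: $\mathbb{D}=\{z\in\mathbb{C}:|z|<1\}$, $\mathbb{T}=\partial\mathbb{D}$, $\overline{\mathbb{D}}$ is the closed unit disk. A one-parameter semigroup in $\mathbb{D}$ is a family $(\phi_t)_{t\ge0}$ of holomorphic maps $\phi_t:\mathbb{D}\to\mathbb{D}$ such that (i) $\phi_0=\mathrm{id}_{\mathbb{D}}$; (ii) $\phi_{t+s}=\phi_t\circ\phi_s$ for all $t,s\ge0$; (iii) $\phi_t(z)\to z$ as $t\to0^+$ for every $z\in\mathbb{D}$. All semigroups are assumed non-trivial, i.e. at least one $\phi_t$ differs from $\mathrm{id}_{\mathbb{D}}$. For every one-parameter semigroup, the angular (non-tangential) limit of $\phi_t$ exists at every point of $\mathbb{T}$ for every $t\ge0$, so the extension $\phi_t:\overline{\mathbb{D}}\to\overline{\mathbb{D}}$ is well defined. *)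

(* Defs.v *)
From Stdlib Require Import Reals.
From Coquelicot Require Import Coquelicot.

Open Scope R_scope.

Definition unit_disk (z : C) : Prop := Cmod z < 1.
Definition unit_circle (z : C) : Prop := Cmod z = 1.
Definition closed_unit_disk (z : C) : Prop := Cmod z <= 1.

(** Maps of the disk are represented by total functions [C -> C]; since the
    disk is open, complex differentiability at its points does not depend on
    the values taken outside. *)
Definition holomorphic_on_disk (f : C -> C) : Prop :=
  forall z : C, unit_disk z -> @ex_derive C_AbsRing C_NormedModule f z.

(** Only the times [t >= 0] and the values [phi t z] with [z] in the open disk
    are constrained. *)
Record one_parameter_semigroup (phi : R -> C -> C) : Prop := {
  semigroup_disk : forall (t : R) (z : C),
    0 <= t -> unit_disk z -> unit_disk (phi t z);
  semigroup_holomorphic : forall t : R, 0 <= t -> holomorphic_on_disk (phi t);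
  semigroup_0 : forall z : C, unit_disk z -> phi 0 z = z;
  semigroup_add : forall (t s : R) (z : C),
    0 <= t -> 0 <= s -> unit_disk z -> phi (t + s) z = phi t (phi s z);
  semigroup_lim_0 : forall z : C, unit_disk z ->
    filterlim (fun t : R => phi t z) (at_right 0) (locally z)
}.

Definition nontrivial_semigroup (phi : R -> C -> C) : Prop :=
  exists (t : R) (z : C), 0 <= t /\ unit_disk z /\ phi t z <> z.

(** The Stolz region at [sigma] of aperture [M]; it is empty when [M <= 1]. *)
Definition stolz_region (sigma : C) (M : R) (z : C) : Prop :=
  unit_disk z /\ Cmod (sigma - z)%C < M * (1 - Cmod z).

Definition is_angular_lim (f : C -> C) (sigma l : C) : Prop :=
  forall M : R, 1 < M ->
    filterlim f (within (stolz_region sigma M) (locally sigma)) (locally l).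

(** The value of [phi t] at each boundary point is its angular limit there. *)
Definition extended_by_angular_limits (phi : R -> C -> C) : Prop :=
  forall (t : R) (sigma : C), 0 <= t -> unit_circle sigma ->
    is_angular_lim (phi t) sigma (phi t sigma).

(** The family [(f i)], [i] in [A], of functions from [D] to [C]. *)
Definition uniformly_equicontinuous {I : Type} (A : I -> Prop) (D : R -> Prop)
    (f : I -> R -> C) : Prop :=
  forall eps : R, 0 < eps -> exists delta : R, 0 < delta /\
    forall (i : I) (s t : R), A i -> D s -> D t ->
      Rabs (s - t) < delta -> Cmod (f i s - f i t)%C < eps.

(* Main.v *)
Require Import Defs.
From Stdlib Require Import Reals Lra Lia Classical List.
From Coquelicot Require Import Coquelicot.

(** By the semigroup law, [phi t z - phi s z] equals [phi (t - s) w - w] with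
    [w = phi s z] when [s <= t], and the values on the circle are limits of
    values in the disk. So the theorem amounts to the uniform convergence of
    [phi t] to the identity on the open disk as [t] tends to 0
    ([uniform_displacement]). Pointwise convergence is given and is easily made
    locally uniform; the difficulty lies near the circle, where the speed of
    the trajectories may be unbounded.

    The main tool is a statement about a single holomorphic self-map [f] of the
    disk. The defect [1 - Re (Cconj z * f z)] is nonnegative and dominates half
    the square of [Cmod (f z - z)], and on the circle of radius [r] it is the
    real part of a holomorphic function: there [Cconj z = r ^ 2 / z], and the
    pole that this creates at 0 can be reflected away. If [f] almost fixes 0
    and 1/2, the corresponding Poisson integral is small at 1/2; by positivity
    the defect then has a small mean on the circle ([mean_defect_small]). The
    weak-type inequality for the maximal function turns this into a bound on
    the length of an interval of directions in each of which the defect is large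
    somewhere near the circle ([defect_arc_bound]). Since a path sweeps an
    interval of directions, no path of sizeable diameter can run near the circle
    with a large defect ([path_small_defect]).

    For the semigroup, this is applied to the average of the maps [phi (k h)],
    [k < n], which is again a self-map of the disk. Its defect is the mean of
    the defects, so it dominates half the mean of the squares of
    [Cmod (phi (k h) z - z)], without any cancellation. Suppose now that a
    trajectory travels from [A] to [B], at distance at least [eps], in a very
    short time [t]. Its first portion, inside the disk of radius [eps / 8]
    around [A], contains a point from which the trajectory remains, in
    quadratic mean over the next [4 t] units of time, close to where it is
    ([slow_time]). The last portion before [B] contains such a point as well.
    The two windows of time start within [t] of each other, hence overlap for
    most of their length, and the trajectory cannot be near [A] and near [B]
    at the same times ([slow_times_close]).

    The only theorem of complex analysis in use is Poisson's formula. It follows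
    from the mean value property, which is Goursat's lemma on a rectangle in
    logarithmic polar coordinates. *)

(** * Goursat's lemma *)

Lemma ex_RInt_Rplus (f g : R -> R) (a b : R) :
  ex_RInt f a b -> ex_RInt g a b -> ex_RInt (fun x => f x + g x) a b.
Proof. exact (ex_RInt_plus (V := R_NormedModule) f g a b). Qed.

Lemma ex_RInt_Rminus (f g : R -> R) (a b : R) :
  ex_RInt f a b -> ex_RInt g a b -> ex_RInt (fun x => f x - g x) a b.
Proof. exact (ex_RInt_minus (V := R_NormedModule) f g a b). Qed.

Lemma ex_RInt_Rmult_const (k : R) (f : R -> R) (a b : R) :
  ex_RInt f a b -> ex_RInt (fun x => k * f x) a b.
Proof. exact (ex_RInt_scal (V := R_NormedModule) f a b k). Qed.

Lemma RInt_Rplus (f g : R -> R) (a b : R) :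
  ex_RInt f a b -> ex_RInt g a b ->
  RInt (fun x => f x + g x) a b = RInt f a b + RInt g a b.
Proof. exact (RInt_plus (V := R_CompleteNormedModule) f g a b). Qed.

Lemma RInt_Rminus (f g : R -> R) (a b : R) :
  ex_RInt f a b -> ex_RInt g a b ->
  RInt (fun x => f x - g x) a b = RInt f a b - RInt g a b.
Proof. exact (RInt_minus (V := R_CompleteNormedModule) f g a b). Qed.

Lemma RInt_Rmult_const (k : R) (f : R -> R) (a b : R) :
  ex_RInt f a b -> RInt (fun x => k * f x) a b = k * RInt f a b.
Proof. exact (RInt_scal (V := R_CompleteNormedModule) f a b k). Qed.

Lemma RInt_Rconst (k a b : R) : RInt (fun _ => k) a b = k * (b - a).
Proof. rewrite RInt_const. apply Rmult_comm. Qed.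

Lemma RInt_near_const (f : R -> R) (a b c e : R) :
  a <= b -> ex_RInt f a b ->
  (forall x, a <= x <= b -> Rabs (f x - c) <= e) ->
  Rabs (RInt f a b - c * (b - a)) <= e * (b - a).
Proof.
  intros Hab Hf Hbound.
  assert (Hlo : RInt (fun _ => c - e) a b <= RInt f a b).
  { apply RInt_le; auto. apply ex_RInt_const.
    intros x Hx. specialize (Hbound x ltac:(lra)).
    apply Rabs_le_between in Hbound. lra. }
  assert (Hup : RInt f a b <= RInt (fun _ => c + e) a b).
  { apply RInt_le; auto. apply ex_RInt_const.
    intros x Hx. specialize (Hbound x ltac:(lra)).
    apply Rabs_le_between in Hbound. lra. }
  rewrite RInt_Rconst in Hlo, Hup.
  apply Rabs_le_between. lra.
Qed.

Lemma nested_intervals (u v : nat -> R) :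
  (forall n, u n <= u (S n)) -> (forall n, v (S n) <= v n) ->
  (forall n, u n <= v n) ->
  exists x, forall n, u n <= x <= v n.
Proof.
  intros Hu Hv Huv.
  assert (Hu' : forall n k, u n <= u (n + k)%nat).
  { intros n k; induction k as [|k IH].
    - rewrite Nat.add_0_r; lra.
    - rewrite Nat.add_succ_r. specialize (Hu (n + k)%nat). lra. }
  assert (Hv' : forall n k, v (n + k)%nat <= v n).
  { intros n k; induction k as [|k IH].
    - rewrite Nat.add_0_r; lra.
    - rewrite Nat.add_succ_r. specialize (Hv (n + k)%nat). lra. }
  assert (Hcross : forall n m, u n <= v m).
  { intros n m.
    pose proof (Hu' n m). pose proof (Hv' m n). pose proof (Huv (n + m)%nat).
    rewrite (Nat.add_comm m n) in *. lra. }
  destruct (completeness (fun x => exists n, x = u n)) as [x [Hub Hlub]].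
  - exists (v O). intros y [n ->]. apply Hcross.
  - exists (u O), O. reflexivity.
  - exists x. intros n. split.
    + apply Hub. exists n; reflexivity.
    + apply Hlub. intros y [m ->]. apply Hcross.
Qed.

Definition rect_integral (p q : R -> R -> R) (x0 x1 y0 y1 : R) : R :=
  RInt (fun x => p x y0) x0 x1 + RInt (q x1) y0 y1
  - RInt (fun x => p x y1) x0 x1 - RInt (q x0) y0 y1.

(** The form [p dx + q dy] has equal cross derivatives at the point. No
    continuity of the derivatives is required, so Green's formula is not at
    hand and the bisection argument is needed. *)
Definition closed_form_at (p q : R -> R -> R) (x y : R) : Prop :=
  exists A B D, differentiable_pt_lim p x y A B
                /\ differentiable_pt_lim q x y B D.

(** A form with affine coefficients and equal cross derivatives integrates to 0
    over every rectangle; what remains is the linearization error, of the order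
    of the diameter times the perimeter. *)
Lemma closed_form_local (p q : R -> R -> R) (X Y : R) :
  closed_form_at p q X Y ->
  forall eps, 0 < eps -> exists delta, 0 < delta /\
  forall x0 x1 y0 y1, x0 <= X <= x1 -> y0 <= Y <= y1 ->
    x1 - x0 < delta -> y1 - y0 < delta ->
    ex_RInt (fun x => p x y0) x0 x1 -> ex_RInt (fun x => p x y1) x0 x1 ->
    ex_RInt (q x0) y0 y1 -> ex_RInt (q x1) y0 y1 ->
    Rabs (rect_integral p q x0 x1 y0 y1)
      <= eps * ((x1 - x0) + (y1 - y0)) ^ 2.
Proof.
  intros (A & B & D & Hp & Hq) eps Heps.
  destruct (Hp (mkposreal (eps / 2) ltac:(lra))) as [d1 H1].
  destruct (Hq (mkposreal (eps / 2) ltac:(lra))) as [d2 H2].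
  simpl in H1, H2.
  exists (Rmin d1 d2). split.
  { apply Rmin_pos; apply cond_pos. }
  intros x0 x1 y0 y1 HX HY Hw Hh I1 I2 I3 I4.
  pose proof (Rmin_l d1 d2). pose proof (Rmin_r d1 d2).
  set (m := (x1 - x0) + (y1 - y0)).
  assert (Hp' : forall x y, x0 <= x <= x1 -> y0 <= y <= y1 ->
    Rabs (p x y - p X Y - (A * (x - X) + B * (y - Y))) <= eps / 2 * m).
  { intros x y Hx Hy.
    eapply Rle_trans.
    - apply H1; apply Rabs_def1; lra.
    - apply Rmult_le_compat_l; [lra|].
      apply Rmax_lub; unfold m; apply Rabs_le; lra. }
  assert (Hq' : forall x y, x0 <= x <= x1 -> y0 <= y <= y1 ->
    Rabs (q x y - q X Y - (B * (x - X) + D * (y - Y))) <= eps / 2 * m).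
  { intros x y Hx Hy.
    eapply Rle_trans.
    - apply H2; apply Rabs_def1; lra.
    - apply Rmult_le_compat_l; [lra|].
      apply Rmax_lub; unfold m; apply Rabs_le; lra. }
  assert (K1 : Rabs (RInt (fun x => p x y0 - p x y1) x0 x1
                     - B * (y0 - y1) * (x1 - x0)) <= eps * m * (x1 - x0)).
  { apply RInt_near_const; [lra | |].
    - apply ex_RInt_Rminus; assumption.
    - intros x Hx.
      pose proof (Hp' x y0 Hx ltac:(lra)) as a1.
      pose proof (Hp' x y1 Hx ltac:(lra)) as a2.
      apply Rabs_le_between in a1. apply Rabs_le_between in a2.
      apply Rabs_le_between. lra. }
  assert (K2 : Rabs (RInt (fun y => q x1 y - q x0 y) y0 y1
                     - B * (x1 - x0) * (y1 - y0)) <= eps * m * (y1 - y0)).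
  { apply RInt_near_const; [lra | |].
    - apply ex_RInt_Rminus; assumption.
    - intros y Hy.
      pose proof (Hq' x0 y ltac:(lra) Hy) as a1.
      pose proof (Hq' x1 y ltac:(lra) Hy) as a2.
      apply Rabs_le_between in a1. apply Rabs_le_between in a2.
      apply Rabs_le_between. lra. }
  rewrite RInt_Rminus in K1 by assumption.
  rewrite RInt_Rminus in K2 by assumption.
  unfold rect_integral.
  replace (eps * m ^ 2) with (eps * m * (x1 - x0) + eps * m * (y1 - y0))
    by (unfold m; ring).
  apply Rabs_le_between in K1. apply Rabs_le_between in K2.
  apply Rabs_le_between. lra.
Qed.

(** Among the quarters of a rectangle, one carries at least a quarter of the
    integral. Repeating the choice yields nested rectangles whose integrals
    decay at most like their areas; by [closed_form_local] at their common point,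
    the first integral is then 0. *)
Section Goursat.

Variables (p q : R -> R -> R) (xa xb : R).
Hypothesis Hclosed : forall x y, xa <= x <= xb -> closed_form_at p q x y.

Lemma closed_form_ex_RInt_l x0 x1 y :
  xa <= x0 -> x0 <= x1 -> x1 <= xb -> ex_RInt (fun x => p x y) x0 x1.
Proof.
  intros H0 H01 H1. apply (ex_RInt_continuous (V := R_CompleteNormedModule)).
  intros x. rewrite Rmin_left, Rmax_right by assumption. intros Hx.
  destruct (Hclosed x y ltac:(lra)) as (A & B & D & Hp & _).

  apply continuity_pt_filterlim.
  assert (Hd : differentiable_pt p x y) by (exists A, B; exact Hp).
  apply differentiable_continuity_pt in Hd.
  intros e He. destruct (Hd (mkposreal e He)) as [d Hd'].
  exists d. split; [apply cond_pos|].
  intros z [_ Hz]. apply Hd'. exact Hz.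
  rewrite Rminus_diag, Rabs_R0. apply cond_pos.
Qed.

Lemma closed_form_ex_RInt_r x y0 y1 :
  xa <= x <= xb -> ex_RInt (q x) y0 y1.
Proof.
  intros Hx. apply (ex_RInt_continuous (V := R_CompleteNormedModule)).
  intros y _.
  destruct (Hclosed x y Hx) as (A & B & D & _ & Hq).
  apply continuity_pt_filterlim.
  assert (Hd : differentiable_pt q x y) by (exists B, D; exact Hq).
  apply differentiable_continuity_pt in Hd.
  intros e He. destruct (Hd (mkposreal e He)) as [d Hd'].
  exists d. split; [apply cond_pos|].
  intros z [_ Hz]. apply Hd'. rewrite Rminus_diag, Rabs_R0. apply cond_pos.
  exact Hz.
Qed.

Lemma rect_integral_quarters x y w h :
  xa <= x -> x + 2 * w <= xb -> 0 <= w ->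
  rect_integral p q x (x + 2 * w) y (y + 2 * h)
  = rect_integral p q x (x + w) y (y + h)
    + rect_integral p q (x + w) (x + 2 * w) y (y + h)
    + rect_integral p q x (x + w) (y + h) (y + 2 * h)
    + rect_integral p q (x + w) (x + 2 * w) (y + h) (y + 2 * h).
Proof.
  intros Hx Hxw Hw. unfold rect_integral.
  assert (Sx : forall Y, RInt (fun t => p t Y) x (x + 2 * w)
    = RInt (fun t => p t Y) x (x + w) + RInt (fun t => p t Y) (x + w) (x + 2 * w)).
  { intros Y. symmetry.
    apply (RInt_Chasles (fun t => p t Y));
      apply closed_form_ex_RInt_l; lra. }
  assert (Sy : forall X, xa <= X <= xb -> RInt (q X) y (y + 2 * h)
    = RInt (q X) y (y + h) + RInt (q X) (y + h) (y + 2 * h)).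
  { intros X HX. symmetry.
    apply (RInt_Chasles (q X));
      apply closed_form_ex_RInt_r; lra. }
  rewrite !Sx, (Sy x), (Sy (x + 2 * w)) by lra. ring.
Qed.

Variables (xo yo a b : R).
Hypotheses (Hxo : xa <= xo) (Hxoa : xo + a <= xb) (Ha : 0 <= a) (Hb : 0 <= b).

(** The rectangles of generation [n] all have the sides [a / 2 ^ n] and
    [b / 2 ^ n], so the lower left corner [c] determines them. *)
Definition cell_integral (n : nat) (c : R * R) : R :=
  rect_integral p q (fst c) (fst c + a / 2 ^ n) (snd c) (snd c + b / 2 ^ n).

Definition next_cell (n : nat) (c : R * R) : R * R :=
  let w := a / 2 ^ S n in
  let h := b / 2 ^ S n in
  let big c' := Rle_dec (Rabs (cell_integral n c) / 4)
                        (Rabs (cell_integral (S n) c')) in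
  if big c then c
  else if big (fst c + w, snd c) then (fst c + w, snd c)
  else if big (fst c, snd c + h) then (fst c, snd c + h)
  else (fst c + w, snd c + h).

Fixpoint cell (n : nat) : R * R :=
  match n with O => (xo, yo) | S n => next_cell n (cell n) end.

Lemma half_pow (u : R) n : u / 2 ^ n = 2 * (u / 2 ^ S n).
Proof. simpl. field. apply pow_nonzero; lra. Qed.

Lemma div_pow_nonneg (u : R) n : 0 <= u -> 0 <= u / 2 ^ n.
Proof.
  intros Hu. apply Rdiv_le_0_compat; auto. apply pow_lt; lra.
Qed.

Lemma next_cell_corner n c :
  (fst (next_cell n c) = fst c \/ fst (next_cell n c) = fst c + a / 2 ^ S n) /\
  (snd (next_cell n c) = snd c \/ snd (next_cell n c) = snd c + b / 2 ^ S n).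
Proof.
  unfold next_cell.
  destruct Rle_dec; [split; left; reflexivity|].
  destruct Rle_dec; [split; [right|left]; reflexivity|].
  destruct Rle_dec; [split; [left|right]; reflexivity|].
  split; right; reflexivity.
Qed.

Lemma next_cell_integral n c :
  xa <= fst c -> fst c + a / 2 ^ n <= xb ->
  Rabs (cell_integral n c) / 4 <= Rabs (cell_integral (S n) (next_cell n c)).
Proof.
  intros H1 H2.
  assert (E : cell_integral n c
    = cell_integral (S n) c
      + cell_integral (S n) (fst c + a / 2 ^ S n, snd c)
      + cell_integral (S n) (fst c, snd c + b / 2 ^ S n)
      + cell_integral (S n) (fst c + a / 2 ^ S n, snd c + b / 2 ^ S n)).
  { unfold cell_integral. cbn [fst snd].
    rewrite (half_pow a n), (half_pow b n).
    rewrite rect_integral_quarters; [|lra| |].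
    - rewrite !(Rplus_assoc (fst c)), !(Rplus_assoc (snd c)).
      rewrite !Rplus_diag. reflexivity.
    - rewrite <- half_pow. lra.
    - apply div_pow_nonneg; lra. }
  pose proof (Rabs_triang
    (cell_integral (S n) c
      + cell_integral (S n) (fst c + a / 2 ^ S n, snd c)
      + cell_integral (S n) (fst c, snd c + b / 2 ^ S n))
      (cell_integral (S n) (fst c + a / 2 ^ S n, snd c + b / 2 ^ S n))) as T1.
  pose proof (Rabs_triang
    (cell_integral (S n) c
      + cell_integral (S n) (fst c + a / 2 ^ S n, snd c))
      (cell_integral (S n) (fst c, snd c + b / 2 ^ S n))) as T2.
  pose proof (Rabs_triang
    (cell_integral (S n) c)
    (cell_integral (S n) (fst c + a / 2 ^ S n, snd c))) as T3.
  unfold next_cell.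
  destruct Rle_dec as [|N1]; [assumption|].
  destruct Rle_dec as [|N2]; [assumption|].
  destruct Rle_dec as [|N3]; [assumption|].
  rewrite E in *. lra.
Qed.

Lemma cell_in_strip n : xa <= fst (cell n) /\ fst (cell n) + a / 2 ^ n <= xb.
Proof.
  induction n as [|n [IH1 IH2]].
  - simpl. split; lra.
  - simpl cell. rewrite (half_pow a n) in IH2.
    pose proof (div_pow_nonneg a (S n) Ha).
    destruct (next_cell_corner n (cell n)) as [[E|E] _]; rewrite E; lra.
Qed.

Lemma cell_integral_lower n :
  Rabs (cell_integral 0 (xo, yo)) / 4 ^ n <= Rabs (cell_integral n (cell n)).
Proof.
  induction n as [|n IH].
  - simpl cell. simpl pow. lra.
  - simpl cell. destruct (cell_in_strip n) as [H1 H2].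
    pose proof (next_cell_integral n (cell n) H1 H2).
    eapply Rle_trans; [|exact H].
    replace (4 ^ S n) with (4 ^ n * 4) by (simpl; ring).
    unfold Rdiv in *. rewrite Rinv_mult, <- Rmult_assoc.
    apply Rmult_le_compat_r; lra.
Qed.

Lemma cell_limit : exists X Y, forall n,
  fst (cell n) <= X <= fst (cell n) + a / 2 ^ n /\
  snd (cell n) <= Y <= snd (cell n) + b / 2 ^ n.
Proof.
  destruct (nested_intervals (fun n => fst (cell n))
             (fun n => fst (cell n) + a / 2 ^ n)) as [X HX].
  - intros n. simpl cell. pose proof (div_pow_nonneg a (S n) Ha).
    destruct (next_cell_corner n (cell n)) as [[E|E] _]; rewrite E; lra.
  - intros n. simpl cell. pose proof (div_pow_nonneg a (S n) Ha).
    rewrite (half_pow a n).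
    destruct (next_cell_corner n (cell n)) as [[E|E] _]; rewrite E; lra.
  - intros n. pose proof (div_pow_nonneg a n Ha). lra.
  - destruct (nested_intervals (fun n => snd (cell n))
               (fun n => snd (cell n) + b / 2 ^ n)) as [Y HY].
    + intros n. simpl cell. pose proof (div_pow_nonneg b (S n) Hb).
      destruct (next_cell_corner n (cell n)) as [_ [E|E]]; rewrite E; lra.
    + intros n. simpl cell. pose proof (div_pow_nonneg b (S n) Hb).
      rewrite (half_pow b n).
      destruct (next_cell_corner n (cell n)) as [_ [E|E]]; rewrite E; lra.
    + intros n. pose proof (div_pow_nonneg b n Hb). lra.
    + exists X, Y. intros n. split; [apply HX | apply HY].
Qed.

Lemma div_pow_small (u d : R) : 0 < d -> exists n, u / 2 ^ n < d.
Proof.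
  intros Hd.
  destruct (Pow_x_infinity 2 ltac:(rewrite Rabs_pos_eq; lra) (u / d + 1))
    as [n Hn].
  exists n. specialize (Hn n (Nat.le_refl n)).
  assert (P : 0 < 2 ^ n) by (apply pow_lt; lra).
  rewrite Rabs_pos_eq in Hn by lra.
  apply (Rmult_lt_reg_r (2 ^ n)); auto.
  unfold Rdiv. rewrite Rmult_assoc, Rinv_l, Rmult_1_r by lra.
  apply (Rmult_lt_reg_r (/ d)). apply Rinv_0_lt_compat; auto.
  replace (d * 2 ^ n * / d) with (2 ^ n) by (field; lra).
  unfold Rdiv in Hn. lra.
Qed.

Lemma cell_integral_0 : cell_integral 0 (xo, yo) = 0.
Proof.
  destruct cell_limit as (X & Y & HXY).
  destruct (Req_dec (cell_integral 0 (xo, yo)) 0) as [E|NE]; [exact E|].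
  exfalso.
  set (M := Rabs (cell_integral 0 (xo, yo))).
  assert (HM : 0 < M) by (apply Rabs_pos_lt; exact NE).
  (* Small enough for the areas: [e * (a + b) ^ 2 < M]. *)
  set (e := M / (2 * ((a + b) ^ 2 + 1))).
  assert (He0 : 0 < (a + b) ^ 2 + 1) by (pose proof (pow2_ge_0 (a + b)); lra).
  assert (He : 0 < e) by (apply Rdiv_lt_0_compat; lra).
  assert (HX : xa <= X <= xb).
  { specialize (HXY O). simpl in HXY. lra. }
  destruct (closed_form_local p q X Y (Hclosed X Y HX) e He) as (d & Hd & Hloc).
  destruct (div_pow_small (a + b) d Hd) as [n Hn].
  assert (Hab : (a + b) / 2 ^ n = a / 2 ^ n + b / 2 ^ n) by (unfold Rdiv; ring).
  pose proof (div_pow_nonneg a n Ha). pose proof (div_pow_nonneg b n Hb).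
  destruct (HXY n) as [h1 h2].
  destruct (cell_in_strip n) as [s1 s2].
  pose proof (Hloc (fst (cell n)) (fst (cell n) + a / 2 ^ n)
    (snd (cell n)) (snd (cell n) + b / 2 ^ n) h1 h2
    ltac:(lra) ltac:(lra)
    ltac:(apply closed_form_ex_RInt_l; lra)
    ltac:(apply closed_form_ex_RInt_l; lra)
    ltac:(apply closed_form_ex_RInt_r; lra)
    ltac:(apply closed_form_ex_RInt_r; lra)) as Hup.
  pose proof (cell_integral_lower n) as Hlow. fold M in Hlow.
  unfold cell_integral at 1 in Hlow.
  assert (P : 0 < 2 ^ n) by (apply pow_lt; lra).
  assert (E4 : 4 ^ n = 2 ^ n * 2 ^ n).
  { rewrite <- Rpow_mult_distr. reflexivity. }
  replace (fst (cell n) + a / 2 ^ n - fst (cell n)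
           + (snd (cell n) + b / 2 ^ n - snd (cell n)))
    with ((a + b) / 2 ^ n) in Hup by (rewrite Hab; ring).
  assert (Hc : M / 4 ^ n <= e * ((a + b) / 2 ^ n) ^ 2) by lra.
  assert (Hc' : M <= e * (a + b) ^ 2).
  { apply (Rmult_le_reg_r (/ 4 ^ n)).
    - apply Rinv_0_lt_compat. apply pow_lt; lra.
    - replace (e * (a + b) ^ 2 * / 4 ^ n) with (e * ((a + b) / 2 ^ n) ^ 2).
      exact Hc. rewrite E4. field. lra. }
  assert (Hc2 : e * ((a + b) ^ 2 + 1) = M / 2).
  { unfold e. field. lra. }
  lra.
Qed.

End Goursat.

Lemma goursat_rectangle (p q : R -> R -> R) (x0 x1 y0 y1 : R) :
  x0 <= x1 -> y0 <= y1 ->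
  (forall x y, x0 <= x <= x1 -> closed_form_at p q x y) ->
  rect_integral p q x0 x1 y0 y1 = 0.
Proof.
  intros Hx Hy Hc.
  pose proof (cell_integral_0 p q x0 x1 Hc x0 y0 (x1 - x0) (y1 - y0)
    (Rle_refl x0) ltac:(lra) ltac:(lra) ltac:(lra)) as H.
  unfold cell_integral in H. simpl in H.
  unfold Rdiv in H. rewrite Rinv_1, !Rmult_1_r, !Rplus_minus in H. exact H.
Qed.

(** * Complex differentiability *)

Lemma Cmod_minus_sym (x y : C) : Cmod (x - y) = Cmod (y - x).
Proof. rewrite <- Cmod_opp. f_equal. ring. Qed.

Lemma Cmod_minus_triangle (x y z : C) :
  Cmod (x - z) <= Cmod (x - y) + Cmod (y - z).
Proof.
  replace (x - z)%C with ((x - y) + (y - z))%C by ring. apply Cmod_triangle.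
Qed.

Lemma Cmod_triangle_inv (x y : C) : Rabs (Cmod x - Cmod y) <= Cmod (x - y).
Proof.
  apply Rabs_le_between. split.
  - pose proof (Cmod_triangle x (y - x)) as H.
    replace (x + (y - x))%C with y in H by ring.
    rewrite (Cmod_minus_sym y x) in H. lra.
  - pose proof (Cmod_triangle y (x - y)) as H.
    replace (y + (x - y))%C with x in H by ring. lra.
Qed.

Lemma Cmod_le_Re_Im (z : C) : Cmod z <= Rabs (Re z) + Rabs (Im z).
Proof.
  apply Rsqr_incr_0_var.
  - unfold Rsqr. pose proof (Cmod2_alt z) as H.
    pose proof (Rabs_pos (Re z)). pose proof (Rabs_pos (Im z)).
    assert (E1 : Rabs (Re z) * Rabs (Re z) = Re z * Re z)
      by (rewrite <- Rabs_mult; apply Rabs_pos_eq; nra).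
    assert (E2 : Rabs (Im z) * Rabs (Im z) = Im z * Im z)
      by (rewrite <- Rabs_mult; apply Rabs_pos_eq; nra).
    nra.
  - pose proof (Rabs_pos (Re z)). pose proof (Rabs_pos (Im z)). lra.
Qed.

Lemma im_le_Cmod (z : C) : Rabs (Im z) <= Cmod z.
Proof.
  pose proof (Rmax_Cmod z). pose proof (Rmax_r (Rabs (fst z)) (Rabs (snd z))).
  unfold Im. lra.
Qed.

(** Continuity for the modulus, as the uniform structure of [C] is that of a
    product of two lines. *)
Definition C_continuous (F : C -> C) (z : C) : Prop :=
  forall eps, 0 < eps -> exists delta, 0 < delta /\
    forall y, Cmod (y - z) < delta -> Cmod (F y - F z) < eps.

Lemma C_continuous_const (c z : C) : C_continuous (fun _ => c) z.
Proof.
  intros eps He. exists 1. split; [lra|]. intros y _.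
  replace (c - c)%C with (0 : C) by ring. rewrite Cmod_0. exact He.
Qed.

Lemma C_continuous_id (z : C) : C_continuous (fun y => y) z.
Proof. intros eps He. exists eps. split; auto. Qed.

Lemma C_continuous_plus (F G : C -> C) (z : C) :
  C_continuous F z -> C_continuous G z -> C_continuous (fun y => F y + G y)%C z.
Proof.
  intros HF HG eps He.
  destruct (HF (eps / 2) ltac:(lra)) as (d1 & Hd1 & H1).
  destruct (HG (eps / 2) ltac:(lra)) as (d2 & Hd2 & H2).
  exists (Rmin d1 d2). split; [apply Rmin_pos; assumption|].
  intros y Hy. pose proof (Rmin_l d1 d2). pose proof (Rmin_r d1 d2).
  specialize (H1 y ltac:(lra)). specialize (H2 y ltac:(lra)).
  replace (F y + G y - (F z + G z))%C with ((F y - F z) + (G y - G z))%C by ring.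
  pose proof (Cmod_triangle (F y - F z) (G y - G z)). lra.
Qed.

Lemma C_continuous_mult (F G : C -> C) (z : C) :
  C_continuous F z -> C_continuous G z -> C_continuous (fun y => F y * G y)%C z.
Proof.
  intros HF HG eps He.
  set (K := 1 + Cmod (F z) + Cmod (G z)).
  pose proof (Cmod_ge_0 (F z)). pose proof (Cmod_ge_0 (G z)).
  set (e := Rmin 1 (eps / (2 * K))).
  assert (HeK : 0 < eps / (2 * K))
    by (apply Rdiv_lt_0_compat; unfold K; lra).
  assert (He0 : 0 < e) by (unfold e; apply Rmin_pos; lra).
  assert (He1 : e <= 1) by apply Rmin_l.
  assert (He2 : e * K <= eps / 2).
  { replace (eps / 2) with (eps / (2 * K) * K) by (unfold K; field; lra).
    apply Rmult_le_compat_r. unfold K; lra. apply Rmin_r. }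
  destruct (HF e He0) as (d1 & Hd1 & H1).
  destruct (HG e He0) as (d2 & Hd2 & H2).
  exists (Rmin d1 d2). split; [apply Rmin_pos; assumption|].
  intros y Hy. pose proof (Rmin_l d1 d2). pose proof (Rmin_r d1 d2).
  specialize (H1 y ltac:(lra)). specialize (H2 y ltac:(lra)).
  replace (F y * G y - F z * G z)%C
    with ((F y - F z) * (G y - G z) + ((F y - F z) * G z + F z * (G y - G z)))%C
    by ring.
  eapply Rle_lt_trans; [apply Cmod_triangle|].
  eapply Rle_lt_trans;
    [apply Rplus_le_compat_l; apply Cmod_triangle|].
  rewrite !Cmod_mult.
  pose proof (Cmod_ge_0 (F y - F z)). pose proof (Cmod_ge_0 (G y - G z)).
  assert (Cmod (F y - F z) * Cmod (G y - G z) <= e * 1)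
    by (apply Rmult_le_compat; lra).
  assert (Cmod (F y - F z) * Cmod (G z) <= e * Cmod (G z))
    by (apply Rmult_le_compat_r; lra).
  assert (Cmod (F z) * Cmod (G y - G z) <= Cmod (F z) * e)
    by (apply Rmult_le_compat_l; lra).
  assert (e * K = e * 1 + (e * Cmod (G z) + Cmod (F z) * e))
    by (unfold K; ring).
  lra.
Qed.

Lemma C_continuous_inv (F : C -> C) (z : C) :
  F z <> 0%C -> C_continuous F z -> C_continuous (fun y => / F y)%C z.
Proof.
  intros Hz HF eps He.
  assert (Hm : 0 < Cmod (F z)) by (apply Cmod_gt_0; exact Hz).
  set (m := Cmod (F z)) in *.
  set (e := Rmin (m / 2) (eps * (m / 2) * m)).
  assert (0 < eps * (m / 2) * m)
    by (apply Rmult_lt_0_compat; [apply Rmult_lt_0_compat|]; lra).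
  assert (He0 : 0 < e) by (apply Rmin_pos; lra).
  destruct (HF e He0) as (d & Hd & H1).
  exists d. split; auto. intros y Hy. specialize (H1 y Hy).
  pose proof (Rmin_l (m / 2) (eps * (m / 2) * m)) as L1.
  pose proof (Rmin_r (m / 2) (eps * (m / 2) * m)) as L2.
  fold e in L1, L2.
  assert (Hy2 : m / 2 < Cmod (F y)).
  { pose proof (Cmod_triangle_inv (F y) (F z)) as T.
    fold m in T. apply Rabs_le_between in T. lra. }
  assert (Hy0 : F y <> 0%C) by (apply Cmod_gt_0; lra).
  replace (/ F y - / F z)%C with ((F z - F y) * (/ F y * / F z))%C
    by (field; auto).
  rewrite !Cmod_mult, !Cmod_inv, Cmod_minus_sym by assumption. fold m.
  apply (Rmult_lt_reg_r (Cmod (F y) * m)).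
  { apply Rmult_lt_0_compat; lra. }
  replace (Cmod (F y - F z) * (/ Cmod (F y) * / m) * (Cmod (F y) * m))
    with (Cmod (F y - F z)) by (field; lra).
  assert (eps * (m / 2) * m <= eps * (Cmod (F y) * m)).
  { rewrite Rmult_assoc. apply Rmult_le_compat_l; [lra|].
    apply Rmult_le_compat_r; lra. }
  lra.
Qed.

Lemma C_continuous_ext_loc (F G : C -> C) (z : C) (d : R) :
  0 < d -> (forall y, Cmod (y - z) < d -> G y = F y) ->
  C_continuous F z -> C_continuous G z.
Proof.
  intros Hd E HF eps He. destruct (HF eps He) as (d' & Hd' & H).
  exists (Rmin d d'). split; [apply Rmin_pos; assumption|].
  intros y Hy. pose proof (Rmin_l d d'). pose proof (Rmin_r d d').
  rewrite (E y) by lra. rewrite (E z).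
  - apply H. lra.
  - replace (z - z)%C with (0 : C) by ring. rewrite Cmod_0. exact Hd.
Qed.

(** Caratheodory's form of differentiability: sums, products and inverses become
    algebraic identities for [Q], and the removable singularities met below are
    filled in by [Q] itself. *)
Definition C_differentiable (F : C -> C) (z : C) : Prop :=
  exists Q : C -> C, C_continuous Q z /\ forall y, (F y - F z = Q y * (y - z))%C.

Lemma C_differentiable_continuous (F : C -> C) (z : C) :
  C_differentiable F z -> C_continuous F z.
Proof.
  intros (Q & HQ & E).
  assert (H : C_continuous (fun y => F z + Q y * (y + - z))%C z).
  { apply C_continuous_plus; [apply C_continuous_const|].
    apply C_continuous_mult; [assumption|].
    apply C_continuous_plus; [apply C_continuous_id | apply C_continuous_const]. }
  apply (C_continuous_ext_loc _ F z 1 Rlt_0_1) in H; [exact H|].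
  intros y _. pose proof (E y) as Ey. unfold Cminus in Ey. rewrite <- Ey. ring.
Qed.

Lemma C_differentiable_const (c z : C) : C_differentiable (fun _ => c) z.
Proof.
  exists (fun _ => 0%C). split; [apply C_continuous_const|]. intros y. ring.
Qed.

Lemma C_differentiable_id (z : C) : C_differentiable (fun y => y) z.
Proof.
  exists (fun _ => 1%C). split; [apply C_continuous_const|]. intros y. ring.
Qed.

Lemma C_differentiable_plus (F G : C -> C) (z : C) :
  C_differentiable F z -> C_differentiable G z -> C_differentiable (fun y => F y + G y)%C z.
Proof.
  intros (Q & HQ & EF) (S & HS & EG).
  exists (fun y => Q y + S y)%C. split; [apply C_continuous_plus; assumption|].
  intros y.
  replace (F y + G y - (F z + G z))%C with ((F y - F z) + (G y - G z))%C by ring.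
  rewrite EF, EG. ring.
Qed.

Lemma C_differentiable_mult (F G : C -> C) (z : C) :
  C_differentiable F z -> C_differentiable G z -> C_differentiable (fun y => F y * G y)%C z.
Proof.
  intros HF HG. pose proof (C_differentiable_continuous G z HG) as CG.
  destruct HF as (Q & HQ & EF). destruct HG as (S & HS & EG).
  exists (fun y => Q y * G y + F z * S y)%C. split.
  - apply C_continuous_plus; apply C_continuous_mult; auto. apply C_continuous_const.
  - intros y.
    replace (F y * G y - F z * G z)%C
      with ((F y - F z) * G y + F z * (G y - G z))%C by ring.
    rewrite EF, EG. ring.
Qed.

Definition slope (F : C -> C) (z l y : C) : C :=
  if Ceq_dec y z then l else ((F y - F z) / (y - z))%C.

Lemma Cminus_neq_0 (y z : C) : y <> z -> (y - z)%C <> 0%C.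
Proof.
  intros H E. apply H. replace y with (y - z + z)%C by ring. rewrite E. ring.
Qed.

Lemma slope_spec (F : C -> C) (z l y : C) :
  (F y - F z = slope F z l y * (y - z))%C.
Proof.
  unfold slope. destruct (Ceq_dec y z) as [->|N]; [ring|].
  field. apply Cminus_neq_0; exact N.
Qed.

Lemma C_differentiable_slope (F : C -> C) (z : C) :
  C_differentiable F z -> exists l, C_continuous (slope F z l) z.
Proof.
  intros (Q & HQ & E). exists (Q z).
  apply (C_continuous_ext_loc Q _ z 1 Rlt_0_1); [|exact HQ].
  intros y _. unfold slope. destruct (Ceq_dec y z) as [->|N]; [reflexivity|].
  rewrite E. field. apply Cminus_neq_0; exact N.
Qed.

Lemma C_differentiable_ext_loc (F G : C -> C) (z : C) (d : R) :
  0 < d -> (forall y, Cmod (y - z) < d -> G y = F y) ->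
  C_differentiable F z -> C_differentiable G z.
Proof.
  intros Hd E HF. destruct (C_differentiable_slope F z HF) as [l Hl].
  exists (slope G z l). split; [|apply slope_spec].
  apply (C_continuous_ext_loc (slope F z l) _ z d Hd); [|exact Hl].
  intros y Hy. unfold slope. rewrite (E y Hy), (E z); [reflexivity|].
  replace (z - z)%C with (0 : C) by ring. rewrite Cmod_0. exact Hd.
Qed.

Lemma C_continuous_neq_0 (F : C -> C) (z : C) :
  F z <> 0%C -> C_continuous F z ->
  exists d, 0 < d /\ forall y, Cmod (y - z) < d -> F y <> 0%C.
Proof.
  intros Hz HF. apply Cmod_gt_0 in Hz.
  destruct (HF _ Hz) as (d & Hd & H). exists d. split; auto.
  intros y Hy E. specialize (H y Hy). rewrite E in H.
  replace (0 - F z)%C with (- F z)%C in H by ring.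
  rewrite Cmod_opp in H. lra.
Qed.

Lemma C_differentiable_inv (F : C -> C) (z : C) :
  F z <> 0%C -> C_differentiable F z -> C_differentiable (fun y => / F y)%C z.
Proof.
  intros Hz HF. pose proof (C_differentiable_continuous F z HF) as CF.
  destruct HF as (Q & HQ & E).
  destruct (C_continuous_neq_0 F z Hz CF) as (d & Hd & Hn).
  exists (slope (fun y => / F y)%C z (- Q z * (/ F z * / F z))%C).
  split; [|exact (slope_spec (fun y => / F y)%C z _)].
  apply (C_continuous_ext_loc (fun y => - (1) * Q y * (/ F y * / F z))%C _ z d Hd).
  - intros y Hy. unfold slope. destruct (Ceq_dec y z) as [->|N].
    + ring.
    + pose proof (Cminus_neq_0 y z N).
      pose proof (Hn y Hy).
      replace (/ F y - / F z)%C with (- (F y - F z) * (/ F y * / F z))%C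
        by (field; auto).
      rewrite E. field. auto.
  - apply C_continuous_mult; apply C_continuous_mult.
    + apply C_continuous_const.
    + exact HQ.
    + apply C_continuous_inv; assumption.
    + apply (C_continuous_const (/ F z)%C).
Qed.

Lemma slope_C_continuous (F : C -> C) (zeta l z : C) :
  z <> zeta -> C_continuous F z -> C_continuous (slope F zeta l) z.
Proof.
  intros N HF.
  assert (P : 0 < Cmod (z - zeta)) by (apply Cmod_gt_0, Cminus_neq_0, N).
  apply (C_continuous_ext_loc (fun y => (F y + - F zeta) * / (y + - zeta))%C _ z _ P).
  - intros y Hy. unfold slope. destruct (Ceq_dec y zeta) as [E|_].
    + rewrite E, Cmod_minus_sym in Hy. lra.
    + reflexivity.
  - apply C_continuous_mult.
    + apply C_continuous_plus; [exact HF | apply C_continuous_const].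
    + apply (C_continuous_inv (fun y => y + - zeta)%C).
      * apply (Cminus_neq_0 z zeta N).
      * apply C_continuous_plus; [apply C_continuous_id | apply C_continuous_const].
Qed.

Lemma slope_C_differentiable (F : C -> C) (zeta l z : C) :
  z <> zeta -> C_differentiable F z -> C_differentiable (slope F zeta l) z.
Proof.
  intros N HF.
  assert (P : 0 < Cmod (z - zeta)) by (apply Cmod_gt_0, Cminus_neq_0, N).
  apply (C_differentiable_ext_loc (fun y => (F y + - F zeta) * / (y + - zeta))%C _ z _ P).
  - intros y Hy. unfold slope. destruct (Ceq_dec y zeta) as [E|_].
    + rewrite E, Cmod_minus_sym in Hy. lra.
    + reflexivity.
  - apply C_differentiable_mult.
    + apply C_differentiable_plus; [exact HF | apply C_differentiable_const].
    + apply (C_differentiable_inv (fun y => y + - zeta)%C).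
      * apply (Cminus_neq_0 z zeta N).
      * apply C_differentiable_plus;
          [apply C_differentiable_id | apply C_differentiable_const].
Qed.

Lemma ex_derive_C_differentiable (F : C -> C) (z : C) :
  @ex_derive C_AbsRing C_NormedModule F z -> C_differentiable F z.
Proof.
  intros [l [_ Hl]]. specialize (Hl z (fun P HP => HP)).
  exists (slope F z l). split; [|apply slope_spec].
  intros eps He.
  destruct (Hl (mkposreal (eps / 2) ltac:(lra))) as [d Hd].
  exists d. split; [apply cond_pos|]. intros y Hy.
  unfold slope at 2. destruct (Ceq_dec z z) as [_|N]; [|elim N; reflexivity].
  specialize (Hd y Hy). simpl in Hd.
  change (Cmod (F y - F z - (y - z) * l) <= eps / 2 * Cmod (y - z)) in Hd.
  unfold slope. destruct (Ceq_dec y z) as [->|N].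
  - replace (l - l)%C with (0 : C) by ring. rewrite Cmod_0. exact He.
  - pose proof (Cminus_neq_0 y z N) as N0.
    replace ((F y - F z) / (y - z) - l)%C
      with ((F y - F z - (y - z) * l) / (y - z))%C by (field; exact N0).
    rewrite Cmod_div by exact N0.
    apply Cmod_gt_0 in N0.
    apply (Rmult_lt_reg_r (Cmod (y - z))); [exact N0|].
    unfold Rdiv. rewrite Rmult_assoc, Rinv_l, Rmult_1_r by lra.
    nra.
Qed.

(** * The mean value property *)

Definition circle_point (r theta : R) : C := (r * cos theta, r * sin theta).

Lemma Cmod_circle_point (r theta : R) : 0 <= r -> Cmod (circle_point r theta) = r.
Proof.
  intros Hr. unfold Cmod, circle_point; simpl.
  replace (r * cos theta * (r * cos theta * 1)
           + r * sin theta * (r * sin theta * 1))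
    with (r ^ 2 * (Rsqr (sin theta) + Rsqr (cos theta)))
    by (unfold Rsqr; ring).
  rewrite sin2_cos2, Rmult_1_r, sqrt_pow2; auto.
Qed.

Lemma circle_point_0 (theta : R) : circle_point 0 theta = 0%C.
Proof. unfold circle_point. rewrite !Rmult_0_l. reflexivity. Qed.

Lemma circle_point_periodic (r th : R) : circle_point r (2 * PI + th) = circle_point r th.
Proof.
  unfold circle_point.
  rewrite (Rplus_comm (2 * PI)), cos_plus, sin_plus, cos_2PI, sin_2PI.
  f_equal; ring.
Qed.

Lemma circle_point_continuity_2d (x y : R) (F : C -> C) :
  C_continuous F (circle_point x y) ->
  forall eps : posreal,
    locally_2d (fun u v => Cmod (F (circle_point u v) - F (circle_point x y)) < eps) x y.
Proof.
  intros HF eps. destruct (HF eps (cond_pos eps)) as (d & Hd & H).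
  assert (Hre : continuity_2d_pt (fun u v => u * cos v) x y).
  { apply continuity_2d_pt_mult; [apply continuity_2d_pt_id1|].
    apply (continuity_1d_2d_pt_comp cos (fun _ v => v));
      [apply continuity_cos | apply continuity_2d_pt_id2]. }
  assert (Him : continuity_2d_pt (fun u v => u * sin v) x y).
  { apply continuity_2d_pt_mult; [apply continuity_2d_pt_id1|].
    apply (continuity_1d_2d_pt_comp sin (fun _ v => v));
      [apply continuity_sin | apply continuity_2d_pt_id2]. }
  destruct (Hre (mkposreal (d / 2) ltac:(lra))) as [d1 H1].
  destruct (Him (mkposreal (d / 2) ltac:(lra))) as [d2 H2].
  simpl in H1, H2.
  exists (mkposreal (Rmin d1 d2) (Rmin_pos _ _ (cond_pos d1) (cond_pos d2))).
  simpl. intros u v Hu Hv.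
  pose proof (Rmin_l d1 d2). pose proof (Rmin_r d1 d2).
  apply H. eapply Rle_lt_trans; [apply Cmod_le_Re_Im|].
  specialize (H1 u v ltac:(lra) ltac:(lra)).
  specialize (H2 u v ltac:(lra) ltac:(lra)).
  unfold Re, Im, circle_point; simpl. unfold Rminus in *. lra.
Qed.

Lemma continuity_2d_circle_point_Re (x y : R) (F : C -> C) :
  C_continuous F (circle_point x y) ->
  continuity_2d_pt (fun r theta => Re (F (circle_point r theta))) x y.
Proof.
  intros HF eps. destruct (circle_point_continuity_2d x y F HF eps) as [d H].
  exists d. intros u v Hu Hv. eapply Rle_lt_trans; [|apply (H u v Hu Hv)].
  apply (re_le_Cmod (F (circle_point u v) - F (circle_point x y))).
Qed.

Lemma continuity_2d_pt_section (f : R -> R -> R) (x y : R) :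
  continuity_2d_pt f x y -> continuous (f x) y.
Proof.
  intros H. apply continuity_pt_filterlim. intros e He.
  destruct (H (mkposreal e He)) as [d Hd]. exists d. split; [apply cond_pos|].
  intros z [_ Hz]. apply Hd; [|exact Hz].
  rewrite Rminus_diag, Rabs_R0. apply cond_pos.
Qed.

Lemma continuous_circle_point_Re (r theta : R) (F : C -> C) :
  C_continuous F (circle_point r theta) ->
  continuous (fun th => Re (F (circle_point r th))) theta.
Proof.
  intros HF. apply (continuity_2d_pt_section (fun r th => Re (F (circle_point r th)))).
  apply continuity_2d_circle_point_Re. exact HF.
Qed.

Lemma ex_RInt_circle_point_Re (r a b : R) (F : C -> C) :
  (forall theta, C_continuous F (circle_point r theta)) ->
  ex_RInt (fun th => Re (F (circle_point r th))) a b.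
Proof.
  intros HF. apply (ex_RInt_continuous (V := R_CompleteNormedModule)).
  intros th _. apply continuous_circle_point_Re, HF.
Qed.

Lemma cauchy_riemann (F : C -> C) (x y : R) :
  C_differentiable F (x, y) -> exists a b,
    differentiable_pt_lim (fun u v => Re (F (u, v))) x y a (- b) /\
    differentiable_pt_lim (fun u v => Im (F (u, v))) x y b a.
Proof.
  intros (Q & HQ & E). exists (Re (Q (x, y))), (Im (Q (x, y))).
  assert (Hest : forall eps : posreal, locally_2d (fun u v =>
    Cmod (F (u, v) - F (x, y) - Q (x, y) * ((u, v) - (x, y)))
      <= eps * Rmax (Rabs (u - x)) (Rabs (v - y))) x y).
  { intros eps.
    assert (He2 : 0 < eps / 2) by (pose proof (cond_pos eps); lra).
    destruct (HQ _ He2) as (d & Hd & H).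
    exists (mkposreal (d / 2) ltac:(lra)). simpl. intros u v Hu Hv.
    assert (Hm : Cmod ((u, v) - (x, y)) <= Rabs (u - x) + Rabs (v - y)).
    { apply (Cmod_le_Re_Im ((u, v) - (x, y))%C). }
    specialize (H (u, v) ltac:(lra)).
    replace (F (u, v) - F (x, y) - Q (x, y) * ((u, v) - (x, y)))%C
      with ((Q (u, v) - Q (x, y)) * ((u, v) - (x, y)))%C by (rewrite E; ring).
    rewrite Cmod_mult.
    pose proof (Rmax_l (Rabs (u - x)) (Rabs (v - y))).
    pose proof (Rmax_r (Rabs (u - x)) (Rabs (v - y))).
    apply Rle_trans with (eps / 2 * (Rabs (u - x) + Rabs (v - y))).
    - apply Rmult_le_compat; try apply Cmod_ge_0; lra.
    - nra. }
  split; intros eps; destruct (Hest eps) as [d Hd]; exists d;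
    intros u v Hu Hv; (eapply Rle_trans; [|apply (Hd u v Hu Hv)]).
  - eapply Rle_trans; [|apply re_le_Cmod]. right. f_equal.
    unfold Re, Im. simpl. ring.
  - eapply Rle_trans; [|apply im_le_Cmod]. right. f_equal.
    unfold Re, Im. simpl. ring.
Qed.

Lemma differentiable_exp_mult (g : R -> R) (x y l : R) :
  (forall y, is_derive g y (Derive g y)) -> Derive g y = l ->
  differentiable_pt_lim (fun u v => exp u * g v) x y (exp x * g y) (exp x * l).
Proof.
  intros Hg <-. apply filterdiff_differentiable_pt_lim.
  apply (is_derive_filterdiff (fun u v => exp u * g v) x y
           (fun u v => exp u * g v)).
  - apply filter_forall. intros u. auto_derive; [exact I | ring].
  - apply (is_derive_scal g y (exp x)), Hg.
  - apply (continuity_2d_pt_filterlim (fun u v => exp u * g v)).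
    apply continuity_2d_pt_mult.
    + apply (continuity_1d_2d_pt_comp exp (fun u _ => u)).
      apply derivable_continuous_pt, derivable_pt_exp.
      apply continuity_2d_pt_id1.
    + apply (continuity_1d_2d_pt_comp g (fun _ v => v)).
      apply continuity_pt_filterlim.
      apply (ex_derive_continuous (K := R_AbsRing) (V := R_NormedModule)).
      exists (Derive g y); apply Hg.
      apply continuity_2d_pt_id2.
Qed.

(** The form is the real part of [F w dw / (i w)] in the coordinate
    [log w = x + i y]; the equality of its cross derivatives is a Cauchy-Riemann
    equation for [F] after the exponential. *)
Lemma closed_form_log_polar (F : C -> C) (x y : R) :
  C_differentiable F (circle_point (exp x) y) ->
  closed_form_at (fun x y => Im (F (circle_point (exp x) y)))
                 (fun x y => Re (F (circle_point (exp x) y))) x y.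
Proof.
  intros HF. unfold circle_point in HF.
  destruct (cauchy_riemann F _ _ HF) as (a & b & H1 & H2).
  assert (Dc : differentiable_pt_lim (fun u v => exp u * cos v) x y
                 (exp x * cos y) (exp x * - sin y)).
  { apply differentiable_exp_mult.
    - intros z. rewrite (is_derive_unique _ _ _ (is_derive_cos z)).
      apply is_derive_cos.
    - apply is_derive_unique, is_derive_cos. }
  assert (Ds : differentiable_pt_lim (fun u v => exp u * sin v) x y
                 (exp x * sin y) (exp x * cos y)).
  { apply differentiable_exp_mult.
    - intros z. rewrite (is_derive_unique _ _ _ (is_derive_sin z)).
      apply is_derive_sin.
    - apply is_derive_unique, is_derive_sin. }
  pose proof (differentiable_pt_lim_comp _ _ _ _ _ _ _ _ _ _ _ H1 Dc Ds) as K1.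
  pose proof (differentiable_pt_lim_comp _ _ _ _ _ _ _ _ _ _ _ H2 Dc Ds) as K2.
  exists (b * (exp x * cos y) + a * (exp x * sin y)).
  exists (a * (exp x * cos y) + - b * (exp x * sin y)).
  exists (a * (exp x * - sin y) + - b * (exp x * cos y)).
  split; [|exact K1].
  replace (a * (exp x * cos y) + - b * (exp x * sin y))
    with (b * (exp x * - sin y) + a * (exp x * cos y)) by ring.
  exact K2.
Qed.

Definition circle_integral (F : C -> C) (r : R) : R :=
  RInt (fun th => Re (F (circle_point r th))) 0 (2 * PI).

(** Goursat's lemma on the rectangle between the angles 0 and [2 * PI], whose
    horizontal sides cancel by periodicity. *)
Lemma circle_integral_locally_constant (F : C -> C) (r1 r2 : R) :
  0 < r1 -> r1 <= r2 ->
  (forall z, r1 <= Cmod z <= r2 -> C_differentiable F z) ->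
  circle_integral F r1 = circle_integral F r2.
Proof.
  intros H1 H12 HF.
  pose proof PI_RGT_0.
  assert (G : rect_integral (fun x y => Im (F (circle_point (exp x) y)))
    (fun x y => Re (F (circle_point (exp x) y))) (ln r1) (ln r2) 0 (2 * PI) = 0).
  { apply goursat_rectangle; [apply ln_le; lra | lra |].
    intros x y [Hx1 Hx2]. apply closed_form_log_polar. apply HF.
    rewrite Cmod_circle_point by (left; apply exp_pos).
    rewrite <- (exp_ln r1) by lra. rewrite <- (exp_ln r2) by lra.
    split.
    - destruct Hx1 as [Hx1| ->];
        [left; apply exp_increasing; exact Hx1 | right; reflexivity].
    - destruct Hx2 as [Hx2| ->];
        [left; apply exp_increasing; exact Hx2 | right; reflexivity]. }
  unfold rect_integral in G. rewrite !exp_ln in G by lra.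
  assert (E : RInt (fun x => Im (F (circle_point (exp x) (2 * PI)))) (ln r1) (ln r2)
    = RInt (fun x => Im (F (circle_point (exp x) 0))) (ln r1) (ln r2)).
  { apply RInt_ext. intros x _. unfold circle_point.
    rewrite cos_2PI, sin_2PI, cos_0, sin_0. reflexivity. }
  unfold circle_integral. lra.
Qed.

Lemma circle_integral_continuous (F : C -> C) (R0 r0 : R) :
  0 <= r0 <= R0 -> (forall z, Cmod z <= R0 -> C_continuous F z) ->
  forall eps, 0 < eps -> exists delta, 0 < delta /\
  forall r, 0 <= r <= R0 -> Rabs (r - r0) < delta ->
    Rabs (circle_integral F r - circle_integral F r0) < eps.
Proof.
  intros Hr0 HF eps He. pose proof PI_RGT_0 as HPI.
  assert (He' : 0 < eps / (4 * PI)) by (apply Rdiv_lt_0_compat; lra).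
  assert (Hc : forall r th, 0 <= r <= R0 -> C_continuous F (circle_point r th)).
  { intros r th Hr. apply HF. rewrite Cmod_circle_point; lra. }
  destruct (uniform_continuity_2d (fun r th => Re (F (circle_point r th)))
    0 R0 0 (2 * PI)
    ltac:(intros x y Hx _; apply continuity_2d_circle_point_Re, Hc, Hx)
    (mkposreal _ He')) as [d Hd].
  simpl in Hd. exists d. split; [apply cond_pos|].
  intros r Hr Hrd. unfold circle_integral.
  assert (I1 : ex_RInt (fun th => Re (F (circle_point r th))) 0 (2 * PI)).
  { apply ex_RInt_circle_point_Re. intros th; apply Hc, Hr. }
  assert (I2 : ex_RInt (fun th => Re (F (circle_point r0 th))) 0 (2 * PI)).
  { apply ex_RInt_circle_point_Re. intros th; apply Hc, Hr0. }
  rewrite <- RInt_Rminus by assumption.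
  pose proof (RInt_near_const
    (fun th => Re (F (circle_point r th)) - Re (F (circle_point r0 th)))
    0 (2 * PI) 0 (eps / (4 * PI)) ltac:(lra)
    (ex_RInt_Rminus _ _ _ _ I1 I2)) as K.
  replace (eps / (4 * PI) * (2 * PI - 0)) with (eps / 2) in K by (field; lra).
  rewrite Rmult_0_l, Rminus_0_r in K.
  eapply Rle_lt_trans; [apply K|lra].
  intros th Hth. rewrite Rminus_0_r. left. apply Hd; auto.
  rewrite Rminus_diag, Rabs_R0. apply cond_pos.
Qed.

(** Continuity suffices at the centre and on one circle, because the integral is
    continuous in the radius. This covers functions with a removable singularity
    that is only known to be a point of continuity. *)
Lemma mean_value_property (F : C -> C) (R0 r0 : R) :
  0 < r0 < R0 ->
  (forall z, Cmod z <= R0 -> C_continuous F z) ->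
  (forall z, 0 < Cmod z <= R0 -> Cmod z <> r0 -> C_differentiable F z) ->
  circle_integral F R0 = 2 * PI * Re (F 0%C).
Proof.
  intros Hr Hc Hd.
  assert (E0 : circle_integral F 0 = 2 * PI * Re (F 0%C)).
  { unfold circle_integral. rewrite (RInt_ext _ (fun _ => Re (F 0%C))).
    - rewrite RInt_Rconst. ring.
    - intros x _. rewrite circle_point_0. reflexivity. }
  rewrite <- E0.
  assert (Hlim : forall a b K, 0 <= a <= R0 -> 0 <= b <= R0 -> a <> b ->
    (forall r, Rmin a b < r < Rmax a b -> circle_integral F r = K) ->
    circle_integral F a = K).
  { intros a b K Ha Hb Hab HK.
    destruct (Req_dec (circle_integral F a) K) as [E|N]; [exact E|].
    exfalso.
    assert (P : 0 < Rabs (circle_integral F a - K)) by (apply Rabs_pos_lt; lra).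
    destruct (circle_integral_continuous F R0 a Ha Hc _ P) as (d & Hd0 & H).
    assert (Hex : exists r, Rmin a b < r < Rmax a b /\ Rabs (r - a) < d).
    { unfold Rmin, Rmax. destruct (Rle_dec a b).
      - exists (Rmin ((a + b) / 2) (a + d / 2)).
        assert (a < Rmin ((a + b) / 2) (a + d / 2))
          by (apply Rmin_glb_lt; lra).
        pose proof (Rmin_l ((a + b) / 2) (a + d / 2)).
        pose proof (Rmin_r ((a + b) / 2) (a + d / 2)).
        split; [lra|]. apply Rabs_def1; lra.
      - exists (Rmax ((a + b) / 2) (a - d / 2)).
        assert (Rmax ((a + b) / 2) (a - d / 2) < a)
          by (apply Rmax_lub_lt; lra).
        pose proof (Rmax_l ((a + b) / 2) (a - d / 2)).
        pose proof (Rmax_r ((a + b) / 2) (a - d / 2)).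
        split; [lra|]. apply Rabs_def1; lra. }
    destruct Hex as (r & Hr1 & Hr2).
    assert (Hr3 : 0 <= r <= R0).
    { pose proof (Rmin_glb a b 0). pose proof (Rmax_lub a b R0). lra. }
    specialize (H r Hr3 Hr2). rewrite (HK r Hr1) in H.
    rewrite Rabs_minus_sym in H. lra. }
  assert (Eout : circle_integral F r0 = circle_integral F R0).
  { apply (Hlim r0 R0); try lra.
    rewrite Rmin_left, Rmax_right by lra. intros r Hr1.
    apply circle_integral_locally_constant; try lra.
    intros z Hz. apply Hd; lra. }
  rewrite <- Eout.
  assert (Ein : forall r, 0 < r < r0 ->
    circle_integral F r = circle_integral F (r0 / 2)).
  { intros r Hr1. destruct (Rle_dec r (r0 / 2)).
    - apply circle_integral_locally_constant; try lra.
      intros z Hz. apply Hd; lra.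
    - symmetry. apply circle_integral_locally_constant; try lra.
      intros z Hz. apply Hd; lra. }
  rewrite (Hlim r0 0 (circle_integral F (r0 / 2))); try lra.
  - symmetry. apply (Hlim 0 r0); try lra.
    rewrite Rmin_left, Rmax_right by lra. exact Ein.
  - rewrite Rmin_right, Rmax_left by lra. exact Ein.
Qed.

(** * Poisson's formula *)

Definition poisson (r : R) (zeta z : C) : R :=
  (r ^ 2 - Cmod zeta ^ 2) / Cmod (z - zeta) ^ 2.

Lemma Re_RtoC_mult (a : R) (w : C) : Re (RtoC a * w) = a * Re w.
Proof. unfold Re, RtoC; simpl. ring. Qed.

Lemma Cmod2_RtoC (w : C) : (w * Cconj w)%C = RtoC (Cmod w ^ 2).
Proof. symmetry. apply Cmod2_conj. Qed.

Lemma circle_minus_neq_0 (r : R) (zeta z : C) :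
  Cmod zeta < r -> Cmod z = r -> (z - zeta)%C <> 0%C.
Proof.
  intros H1 H2. apply Cminus_neq_0. intros ->. lra.
Qed.

Lemma circle_neq_0 (r : R) (z : C) : 0 < r -> Cmod z = r -> z <> 0%C.
Proof. intros H1 H2. apply Cmod_gt_0. lra. Qed.

(** The left side is holomorphic in [z] and vanishes only at the reflection of
    [zeta]; through it, the conjugate of [z - zeta] becomes on the circle the
    trace of a meromorphic function without zeros inside. *)
Lemma circle_reflection (r : R) (zeta z : C) :
  Cmod z = r ->
  (RtoC (r ^ 2) - Cconj zeta * z)%C = (z * Cconj (z - zeta))%C.
Proof.
  intros H. rewrite Cminus_conj, <- H, <- Cmod2_RtoC. ring.
Qed.

Lemma reflected_neq_0 (r : R) (zeta z : C) :
  Cmod zeta < r -> Cmod z <= r -> (RtoC (r ^ 2) - Cconj zeta * z)%C <> 0%C.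
Proof.
  intros H1 H2 E.
  assert (E' : RtoC (r ^ 2) = (Cconj zeta * z)%C).
  { rewrite <- (Cplus_0_l (Cconj zeta * z)), <- E. ring. }
  assert (E2 : Cmod (RtoC (r ^ 2)) = Cmod zeta * Cmod z)
    by (rewrite E', Cmod_mult, Cmod_conj; reflexivity).
  rewrite Cmod_R, Rabs_pos_eq in E2 by apply pow2_ge_0.
  pose proof (Cmod_ge_0 zeta). pose proof (Cmod_ge_0 z). nra.
Qed.

Lemma C_differentiable_reflected_inv (r : R) (zeta z : C) :
  Cmod zeta < r -> Cmod z <= r ->
  C_differentiable (fun z => / (RtoC (r ^ 2) + (- Cconj zeta) * z))%C z.
Proof.
  intros H1 H2.
  apply (C_differentiable_inv (fun z => (RtoC (r ^ 2) + (- Cconj zeta) * z)%C)).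
  - replace (RtoC (r ^ 2) + - Cconj zeta * z)%C
      with (RtoC (r ^ 2) - Cconj zeta * z)%C by ring.
    apply reflected_neq_0; assumption.
  - apply C_differentiable_plus; [apply C_differentiable_const|].
    apply C_differentiable_mult; [apply C_differentiable_const | apply C_differentiable_id].
Qed.

Lemma poisson_as_Re (r : R) (zeta z : C) :
  0 < r -> Cmod zeta < r -> Cmod z = r ->
  poisson r zeta z =
  Re (2 * RtoC (r ^ 2) * / (RtoC (r ^ 2) + (- Cconj zeta) * z) + - (1))%C.
Proof.
  intros Hr Hzeta Hz.
  pose proof (circle_minus_neq_0 r zeta z Hzeta Hz) as N1.
  pose proof (circle_neq_0 r z Hr Hz) as N2.
  pose proof (reflected_neq_0 r zeta z Hzeta ltac:(lra)) as N3.
  assert (Nm : Cmod (z - zeta) <> 0) by (apply Cmod_gt_0 in N1; lra).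
  assert (E : (2 * RtoC (r ^ 2) * / (RtoC (r ^ 2) + (- Cconj zeta) * z) + - (1)
    = RtoC (/ Cmod (z - zeta) ^ 2)
      * ((Cconj z + Cconj zeta) * (z - zeta)))%C).
  { rewrite RtoC_inv by (apply pow_nonzero; exact Nm).
    rewrite <- Cmod2_RtoC.
    replace (RtoC (r ^ 2) + - Cconj zeta * z)%C
      with (RtoC (r ^ 2) - Cconj zeta * z)%C by ring.
    rewrite (circle_reflection r zeta z Hz) in *.
    assert (N4 : Cconj (z - zeta) <> 0%C).
    { intros E0. apply N3. rewrite E0. ring. }
    replace (RtoC (r ^ 2)) with (z * Cconj z)%C by (rewrite <- Hz; apply Cmod2_RtoC).
    rewrite Cminus_conj in *. field. auto. }
  rewrite E, Re_RtoC_mult. unfold poisson, Rdiv. rewrite Rmult_comm.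
  f_equal.
  rewrite <- Hz, !Cmod2_alt. unfold Re, Im; simpl. ring.
Qed.

Lemma poisson_continuous (r : R) (zeta : C) (th : R) :
  0 < r -> Cmod zeta < r ->
  continuous (fun th => poisson r zeta (circle_point r th)) th.
Proof.
  intros Hr Hz.
  apply (continuous_ext
    (fun th => Re ((fun z : C => 2 * RtoC (r ^ 2) * /
      (RtoC (r ^ 2) + (- Cconj zeta) * z) + - (1)) (circle_point r th))%C)).
  - intros x. symmetry. apply poisson_as_Re; rewrite ?Cmod_circle_point; lra.
  - apply (continuous_circle_point_Re r th (fun z : C => 2 * RtoC (r ^ 2) * /
      (RtoC (r ^ 2) + (- Cconj zeta) * z) + - (1))%C).
    apply C_differentiable_continuous.
    apply C_differentiable_plus; [|apply C_differentiable_const].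
    apply C_differentiable_mult; [apply C_differentiable_const|].
    apply C_differentiable_reflected_inv; rewrite ?Cmod_circle_point; lra.
Qed.

Lemma ex_RInt_poisson_mult (r : R) (zeta : C) (g : R -> R) (a b : R) :
  0 < r -> Cmod zeta < r -> (forall th, continuous g th) ->
  ex_RInt (fun th => poisson r zeta (circle_point r th) * g th) a b.
Proof.
  intros Hr Hz Hg. apply (ex_RInt_continuous (V := R_CompleteNormedModule)).
  intros th _. apply (continuous_mult (K := R_AbsRing)).
  apply poisson_continuous; assumption. apply Hg.
Qed.

Lemma RInt_poisson (r : R) (zeta : C) :
  0 < r -> Cmod zeta < r ->
  RInt (fun th => poisson r zeta (circle_point r th)) 0 (2 * PI) = 2 * PI.
Proof.
  intros Hr Hzeta.
  pose (G := fun z : C => (2 * RtoC (r ^ 2) * / (RtoC (r ^ 2) + (- Cconj zeta) * z)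
                       + - (1))%C).
  assert (HG : forall z, Cmod z <= r -> C_differentiable G z).
  { intros z Hz. unfold G.
    apply C_differentiable_plus; [|apply C_differentiable_const].
    apply C_differentiable_mult; [apply C_differentiable_const|].
    apply C_differentiable_reflected_inv; lra. }
  pose proof (mean_value_property G r (r / 2) ltac:(lra)
    (fun z Hz => C_differentiable_continuous G z (HG z Hz))
    (fun z Hz _ => HG z (proj2 Hz))) as M.
  assert (E0 : G 0%C = 1%C).
  { unfold G. rewrite Cmult_0_r, Cplus_0_r.
    assert (N : RtoC (r ^ 2) <> 0%C).
    { intros E. apply RtoC_inj in E. pose proof (pow_lt r 2 Hr). lra. }
    set (w := RtoC (r ^ 2)) in *. field. exact N. }
  rewrite E0 in M. unfold circle_integral in M.
  replace (2 * PI * Re 1%C) with (2 * PI) in M by (simpl; ring).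
  etransitivity; [|exact M].
  apply RInt_ext. intros th _.
  apply poisson_as_Re; rewrite ?Cmod_circle_point; lra.
Qed.

(** For [zeta] other than 0, this is the mean value property of
    [k z * (F z - F zeta) / (z - zeta)]. The factor [k] is holomorphic inside the
    circle, vanishes at 0, and makes the coefficient of [F z - F zeta] on the
    circle equal to the Poisson kernel, a real number. *)
Lemma poisson_formula (F : C -> C) (r : R) (zeta : C) :
  0 < r -> Cmod zeta < r ->
  (forall z, Cmod z <= r -> C_continuous F z) ->
  (forall z, 0 < Cmod z <= r -> C_differentiable F z) ->
  RInt (fun th => poisson r zeta (circle_point r th) * Re (F (circle_point r th)))
    0 (2 * PI)
  = 2 * PI * Re (F zeta).
Proof.
  intros Hr Hzeta Hc Hd.
  destruct (Ceq_dec zeta 0) as [->|Nz].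
  { rewrite <- (mean_value_property F r (r / 2)); try lra; auto.
    unfold circle_integral. apply RInt_ext. intros th _.
    rewrite <- (Rmult_1_l (Re _)) at 2. f_equal.
    unfold poisson, Cminus. rewrite Copp_0, Cplus_0_r, Cmod_circle_point, Cmod_0 by lra.
    field. lra. }
  assert (Hz0 : 0 < Cmod zeta) by (apply Cmod_gt_0; exact Nz).
  destruct (C_differentiable_slope F zeta (Hd zeta ltac:(lra))) as [l Hl].
  pose (k := fun z : C =>
    (z * (RtoC (r ^ 2 - Cmod zeta ^ 2) * / (RtoC (r ^ 2) + (- Cconj zeta) * z)))%C).
  assert (Hk : forall z, Cmod z <= r -> C_differentiable k z).
  { intros z Hz. apply C_differentiable_mult; [apply C_differentiable_id|].
    apply C_differentiable_mult; [apply C_differentiable_const|].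
    apply C_differentiable_reflected_inv; lra. }
  assert (HS : forall z, Cmod z <= r -> C_continuous (slope F zeta l) z).
  { intros z Hz. destruct (Ceq_dec z zeta) as [->|N]; [exact Hl|].
    apply slope_C_continuous; [exact N | apply Hc, Hz]. }
  pose proof (mean_value_property (fun z => k z * slope F zeta l z)%C r
    (Cmod zeta) ltac:(lra)) as M.
  assert (K0 : (k 0 * slope F zeta l 0)%C = 0%C) by (unfold k; ring).
  cbv beta in M. rewrite K0 in M.
  replace (2 * PI * Re 0%C) with 0 in M by (simpl; ring).
  unfold circle_integral in M.
  assert (Ir : ex_RInt (fun th => poisson r zeta (circle_point r th)
                                  * Re (F (circle_point r th))) 0 (2 * PI)).
  { apply (ex_RInt_poisson_mult r zeta (fun th => Re (F (circle_point r th)))); auto.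
    intros th. apply continuous_circle_point_Re, Hc. rewrite Cmod_circle_point; lra. }
  assert (Ip : ex_RInt (fun th => poisson r zeta (circle_point r th)) 0 (2 * PI)).
  { apply (ex_RInt_continuous (V := R_CompleteNormedModule)).
    intros th _. apply poisson_continuous; assumption. }
  rewrite (RInt_ext _ (fun th =>
    poisson r zeta (circle_point r th) * Re (F (circle_point r th))
    - Re (F zeta) * poisson r zeta (circle_point r th))) in M.
  - rewrite RInt_Rminus, RInt_Rmult_const, RInt_poisson in M; auto.
    + rewrite (Rmult_comm (2 * PI)). apply Rminus_diag_uniq. apply M.
      * intros z Hz. apply C_continuous_mult;
          [apply C_differentiable_continuous, Hk | apply HS]; lra.
      * intros z Hz Nz'. apply C_differentiable_mult; [apply Hk; lra|].
        apply slope_C_differentiable; [intros ->; lra | apply Hd; lra].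
    + apply ex_RInt_Rmult_const; assumption.
  - intros th _.
    assert (Hm : Cmod (circle_point r th) = r) by (apply Cmod_circle_point; lra).
    set (z := circle_point r th) in *.
    pose proof (circle_minus_neq_0 r zeta z Hzeta Hm) as N1.
    pose proof (circle_neq_0 r z Hr Hm) as N2.
    pose proof (reflected_neq_0 r zeta z Hzeta ltac:(lra)) as N3.
    assert (Nm : Cmod (z - zeta) <> 0) by (apply Cmod_gt_0 in N1; lra).
    assert (E : (k z * slope F zeta l z
                 = RtoC (poisson r zeta z) * (F z - F zeta))%C).
    { unfold slope. destruct (Ceq_dec z zeta) as [E|_].
      { elim N1. rewrite E. ring. }
      unfold k, poisson.
      rewrite RtoC_div by (apply pow_nonzero; exact Nm).
      rewrite <- (Cmod2_RtoC (z - zeta)).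
      replace (RtoC (r ^ 2) + - Cconj zeta * z)%C
        with (RtoC (r ^ 2) - Cconj zeta * z)%C by ring.
      rewrite (circle_reflection r zeta z Hm) in *.
      assert (N4 : Cconj (z - zeta) <> 0%C).
      { intros E0. apply N3. rewrite E0. ring. }
      field. auto. }
    rewrite E, Re_RtoC_mult. unfold Re; simpl. ring.
Qed.

Lemma poisson_bounds (r : R) (zeta z : C) :
  0 < r -> Cmod zeta < r -> Cmod z = r ->
  (r - Cmod zeta) / (r + Cmod zeta) <= poisson r zeta z
    <= (r + Cmod zeta) / (r - Cmod zeta).
Proof.
  intros Hr Hzeta Hz. pose proof (Cmod_ge_0 zeta).
  assert (L : r - Cmod zeta <= Cmod (z - zeta)).
  { pose proof (Cmod_triangle_inv z zeta) as T.
    apply Rabs_le_between in T. lra. }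
  assert (U : Cmod (z - zeta) <= r + Cmod zeta).
  { pose proof (Cmod_triangle z (- zeta)) as T.
    rewrite Cmod_opp in T. unfold Cminus. lra. }
  unfold poisson. set (d := Cmod (z - zeta)) in *. set (s := Cmod zeta) in *.
  replace (r ^ 2 - s ^ 2) with ((r - s) * (r + s)) by ring.
  split.
  - replace ((r - s) / (r + s)) with ((r - s) * (r + s) / (r + s) ^ 2)
      by (field; lra).
    apply Rmult_le_compat_l; [nra|].
    apply Rinv_le_contravar; [nra|]. apply pow_incr. lra.
  - replace ((r + s) / (r - s)) with ((r - s) * (r + s) / (r - s) ^ 2)
      by (field; lra).
    apply Rmult_le_compat_l; [nra|].
    apply Rinv_le_contravar; [nra|]. apply pow_incr. lra.
Qed.

(** * The defect of a self-map of the disk *)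

Definition disk_map (f : C -> C) : Prop :=
  (forall z, Cmod z < 1 -> C_differentiable f z) /\
  (forall z, Cmod z < 1 -> Cmod (f z) < 1).

Definition defect (f : C -> C) (z : C) : R := 1 - Re (Cconj z * f z).

Lemma Cmod_minus_sqr (z w : C) :
  Cmod (w - z) ^ 2 = Cmod w ^ 2 + Cmod z ^ 2 - 2 * Re (Cconj z * w).
Proof. rewrite !Cmod2_alt. unfold Re, Im; simpl. ring. Qed.

Lemma defect_lower_bound (f : C -> C) (z : C) :
  disk_map f -> Cmod z < 1 -> Cmod (f z - z) ^ 2 <= 2 * defect f z.
Proof.
  intros [_ Hf] Hz. specialize (Hf z Hz). unfold defect.
  rewrite Cmod_minus_sqr.
  pose proof (Cmod_ge_0 z). pose proof (Cmod_ge_0 (f z)).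
  assert (Cmod z ^ 2 <= 1) by nra. assert (Cmod (f z) ^ 2 <= 1) by nra.
  lra.
Qed.

Lemma defect_ge_0 (f : C -> C) (z : C) :
  disk_map f -> Cmod z < 1 -> 0 <= defect f z.
Proof.
  intros Hf Hz. pose proof (defect_lower_bound f z Hf Hz).
  pose proof (pow2_ge_0 (Cmod (f z - z))). lra.
Qed.

(** A function holomorphic in the disk whose real part is the defect of [f] on the
    circle of radius [r]. There [Cconj z * f z] is
    [r ^ 2 * (f z - f 0) / z + Cconj z * f 0], and the last term has the same real
    part as [Cconj (f 0) * z]. *)
Definition defect_kernel (f : C -> C) (l : C) (r : R) (z : C) : C :=
  (1 + - (1) * (RtoC (r ^ 2) * slope f 0 l z + Cconj (f 0%C) * z))%C.

Lemma defect_kernel_on_circle (f : C -> C) (l : C) (r : R) (z : C) :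
  0 < r -> Cmod z = r -> Re (defect_kernel f l r z) = defect f z.
Proof.
  intros Hr Hz. pose proof (circle_neq_0 r z Hr Hz) as N.
  assert (E : (RtoC (r ^ 2) * slope f 0 l z = Cconj z * (f z - f 0))%C).
  { rewrite <- Hz, <- Cmod2_RtoC. unfold slope.
    destruct (Ceq_dec z 0) as [E|_]; [contradiction|].
    unfold Cminus at 2. rewrite Copp_0, Cplus_0_r. field. exact N. }
  unfold defect_kernel. rewrite E. unfold defect, Re; simpl. ring.
Qed.

Section DiskMap.

Variables (f : C -> C) (l : C).
Hypothesis Hf : disk_map f.
Hypothesis Hl : C_continuous (slope f 0 l) 0%C.

Lemma defect_kernel_C_continuous (r : R) (z : C) :
  Cmod z < 1 -> C_continuous (defect_kernel f l r) z.
Proof.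
  intros Hz. apply C_continuous_plus; [apply C_continuous_const|].
  apply C_continuous_mult; [apply C_continuous_const|].
  apply C_continuous_plus; apply C_continuous_mult; try apply C_continuous_const.
  - destruct (Ceq_dec z 0) as [->|N]; [exact Hl|].
    apply slope_C_continuous; [exact N|]. apply C_differentiable_continuous, (proj1 Hf), Hz.
  - apply C_continuous_id.
Qed.

Lemma defect_kernel_C_differentiable (r : R) (z : C) :
  0 < Cmod z < 1 -> C_differentiable (defect_kernel f l r) z.
Proof.
  intros Hz. apply C_differentiable_plus; [apply C_differentiable_const|].
  apply C_differentiable_mult; [apply C_differentiable_const|].
  apply C_differentiable_plus; apply C_differentiable_mult; try apply C_differentiable_const.
  - apply slope_C_differentiable; [|apply (proj1 Hf); lra].
    apply Cmod_gt_0; lra.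
  - apply C_differentiable_id.
Qed.

End DiskMap.

Lemma disk_map_slope (f : C -> C) :
  disk_map f -> exists l, C_continuous (slope f 0 l) 0%C.
Proof.
  intros Hf. apply C_differentiable_slope, (proj1 Hf). rewrite Cmod_0. lra.
Qed.

Lemma defect_continuous (f : C -> C) (r th : R) :
  disk_map f -> 0 < r < 1 -> continuous (fun th => defect f (circle_point r th)) th.
Proof.
  intros Hf Hr. destruct (disk_map_slope f Hf) as [l Hl].
  apply (continuous_ext (fun th => Re (defect_kernel f l r (circle_point r th)))).
  - intros x. apply defect_kernel_on_circle; rewrite ?Cmod_circle_point; lra.
  - apply continuous_circle_point_Re, defect_kernel_C_continuous; auto.
    rewrite Cmod_circle_point; lra.
Qed.

Lemma poisson_defect (f : C -> C) (r : R) (zeta : C) :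
  disk_map f -> 0 < r < 1 -> 0 < Cmod zeta < r ->
  RInt (fun th => poisson r zeta (circle_point r th) * defect f (circle_point r th))
    0 (2 * PI)
  = 2 * PI * (1 - Re (RtoC (r ^ 2) * ((f zeta - f 0) / zeta)
                      + Cconj (f 0%C) * zeta)%C).
Proof.
  intros Hf Hr Hz. destruct (disk_map_slope f Hf) as [l Hl].
  rewrite (RInt_ext _ (fun th =>
    poisson r zeta (circle_point r th) * Re (defect_kernel f l r (circle_point r th)))).
  - rewrite poisson_formula; try lra.
    + f_equal. unfold defect_kernel, slope.
      destruct (Ceq_dec zeta 0) as [E|_].
      { rewrite E, Cmod_0 in Hz. lra. }
      unfold Cminus at 2. rewrite Copp_0, Cplus_0_r.
      unfold Re; simpl. ring.
    + intros z Hz'. apply defect_kernel_C_continuous; auto; lra.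
    + intros z Hz'. apply defect_kernel_C_differentiable; auto; lra.
  - intros th _. f_equal. symmetry.
    apply defect_kernel_on_circle; rewrite ?Cmod_circle_point; lra.
Qed.

Lemma Re_bounds (z : C) : - Cmod z <= Re z <= Cmod z.
Proof. apply Rabs_le_between, re_le_Cmod. Qed.

Lemma ex_RInt_defect (f : C -> C) (r a b : R) :
  disk_map f -> 0 < r < 1 -> ex_RInt (fun th => defect f (circle_point r th)) a b.
Proof.
  intros Hf Hr. apply (ex_RInt_continuous (V := R_CompleteNormedModule)).
  intros th _. apply defect_continuous; assumption.
Qed.

(** The Poisson integral of the defect at 1/2 is small since [f] almost fixes 0
    and 1/2. The Poisson kernel of the point 1/2 is bounded below by 1/5 and the
    defect is nonnegative, so that its mean is small. *)
Lemma mean_defect_small (f : C -> C) (r delta : R) :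
  disk_map f -> 3 / 4 <= r < 1 -> 1 - r ^ 2 <= delta ->
  Cmod (f 0%C) <= delta -> Cmod (f (RtoC (1 / 2)) - RtoC (1 / 2)) <= delta ->
  RInt (fun th => defect f (circle_point r th)) 0 (2 * PI) <= 2 * PI * (30 * delta).
Proof.
  intros Hf Hr Hrd H0 H1. pose proof PI_RGT_0.
  assert (Hm : Cmod (RtoC (1 / 2)) = 1 / 2) by (rewrite Cmod_R; apply Rabs_pos_eq; lra).
  assert (Hh : RtoC (1 / 2) <> 0%C) by (apply Cmod_gt_0; lra).
  pose proof (poisson_defect f r (RtoC (1 / 2)) Hf ltac:(lra) ltac:(lra)) as P.
  assert (U : 1 - Re (RtoC (r ^ 2) * ((f (RtoC (1 / 2)) - f 0) / RtoC (1 / 2))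
                      + Cconj (f 0%C) * RtoC (1 / 2))%C <= 6 * delta).
  { set (e := (f (RtoC (1 / 2)) - RtoC (1 / 2))%C) in *.
    assert (E : (RtoC (r ^ 2) * ((f (RtoC (1 / 2)) - f 0) / RtoC (1 / 2))
                      + Cconj (f 0%C) * RtoC (1 / 2)
      = RtoC (r ^ 2) * (1 + RtoC 2 * (e - f 0)) + RtoC (1 / 2) * Cconj (f 0))%C).
    { replace (f (RtoC (1 / 2))) with (e + RtoC (1 / 2))%C by (unfold e; ring).
      rewrite RtoC_div by lra. field. }
    rewrite E.
    assert (E2 : Re (RtoC (r ^ 2) * (1 + RtoC 2 * (e - f 0))
                      + RtoC (1 / 2) * Cconj (f 0%C))%C
      = r ^ 2 * (1 + 2 * (Re e - Re (f 0%C))) + 1 / 2 * Re (f 0%C)).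
    { unfold Re; simpl. field. }
    rewrite E2. pose proof (Re_bounds e). pose proof (Re_bounds (f 0%C)).
    assert (r ^ 2 <= 1) by nra. assert (0 <= r ^ 2) by nra.
    assert (- (2 * delta) <= Re e - Re (f 0%C)) by lra.
    nra. }
  assert (L : RInt (fun th => 1 / 5 * defect f (circle_point r th)) 0 (2 * PI)
    <= RInt (fun th => poisson r (RtoC (1 / 2)) (circle_point r th)
                       * defect f (circle_point r th)) 0 (2 * PI)).
  { apply RInt_le; [lra | | |].
    - apply ex_RInt_Rmult_const, ex_RInt_defect; auto; lra.
    - apply (ex_RInt_poisson_mult r _ (fun th => defect f (circle_point r th))); try lra.
      intros th; apply defect_continuous; auto; lra.
    - intros th _. apply Rmult_le_compat_r.
      + apply defect_ge_0; auto. rewrite Cmod_circle_point; lra.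
      + destruct (poisson_bounds r (RtoC (1 / 2)) (circle_point r th)) as [B _];
          rewrite ?Cmod_circle_point; try lra.
        eapply Rle_trans; [|exact B]. rewrite Hm.
        apply (Rmult_le_reg_r (r + 1 / 2)); [lra|].
        replace ((r - 1 / 2) / (r + 1 / 2) * (r + 1 / 2)) with (r - 1 / 2)
          by (field; lra).
        lra. }
  rewrite RInt_Rmult_const in L by (apply ex_RInt_defect; auto; lra).
  rewrite P in L.
  apply Rle_trans with (5 * (2 * PI * (6 * delta))); [|lra].
  assert (2 * PI * (1 - Re (RtoC (r ^ 2) * ((f (RtoC (1 / 2)) - f 0) / RtoC (1 / 2))
                      + Cconj (f 0%C) * RtoC (1 / 2))%C) <= 2 * PI * (6 * delta))
    by (apply Rmult_le_compat_l; lra).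
  lra.
Qed.

Lemma Cmod_rotation (w : C) :
  exists c, Cmod c = 1 /\ (c * w)%C = RtoC (Cmod w).
Proof.
  destruct (Ceq_dec w 0) as [->|N].
  - exists 1%C. rewrite Cmod_1, Cmod_0. split; [reflexivity | ring].
  - assert (P : 0 < Cmod w) by (apply Cmod_gt_0; exact N).
    assert (Q : RtoC (Cmod w) <> 0%C).
    { intros E; apply RtoC_inj in E; lra. }
    exists (Cconj w / RtoC (Cmod w))%C. split.
    + rewrite Cmod_div, Cmod_conj, Cmod_R, Rabs_pos_eq by (auto; lra).
      field. lra.
    + replace (Cconj w / RtoC (Cmod w) * w)%C
        with ((w * Cconj w) / RtoC (Cmod w))%C by (field; exact Q).
      rewrite Cmod2_RtoC. rewrite RtoC_pow. field. exact Q.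
Qed.

(** The estimates on circles improve with the radius; [rho] is the modulus that the
    circle has to enclose. *)
Lemma exists_radius (delta rho : R) :
  0 < delta -> rho < 1 ->
  exists r, 3 / 4 <= r < 1 /\ 1 - r ^ 2 <= delta /\ rho < r.
Proof.
  intros Hd Hrho.
  set (r1 := Rmax (3 / 4) (Rmax (1 - delta / 2) ((1 + rho) / 2))).
  pose proof (Rmax_l (3 / 4) (Rmax (1 - delta / 2) ((1 + rho) / 2))) as A1.
  pose proof (Rmax_r (3 / 4) (Rmax (1 - delta / 2) ((1 + rho) / 2))) as A2.
  pose proof (Rmax_l (1 - delta / 2) ((1 + rho) / 2)) as A3.
  pose proof (Rmax_r (1 - delta / 2) ((1 + rho) / 2)) as A4.
  fold r1 in A1, A2.
  assert (r1 < 1).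
  { unfold r1. apply Rmax_lub_lt; [lra|]. apply Rmax_lub_lt; lra. }
  exists r1. split; [lra|]. split; [nra | lra].
Qed.

(** Poisson's formula bounds the displacement inside the disk by its mean over the
    circle, which the mean of the defect controls. The parameter [a] is the
    weight in Young's inequality. *)
Lemma displacement_inside (f : C -> C) (delta eta a : R) (zeta : C) :
  disk_map f -> 0 < delta -> 0 < eta < 1 -> 0 < a ->
  Cmod (f 0%C) <= delta -> Cmod (f (RtoC (1 / 2)) - RtoC (1 / 2)) <= delta ->
  Cmod zeta <= 1 - eta ->
  Cmod (f zeta - zeta) <= 4 / eta * (a / 2 + 30 * delta / a).
Proof.
  intros Hf Hdelta Heta Ha H0 H1 Hz. pose proof PI_RGT_0.
  destruct (exists_radius delta (1 - eta / 2) Hdelta ltac:(lra))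
    as (r & Hr & Hrd & Hre).
  destruct (Cmod_rotation (f zeta - zeta)) as (c & Hc & Ec).
  pose (F := fun z => (c * (f z + - (1) * z))%C).
  assert (HF : forall z, Cmod z <= r -> C_differentiable F z).
  { intros z Hz'. apply C_differentiable_mult; [apply C_differentiable_const|].
    apply C_differentiable_plus; [apply (proj1 Hf); lra|].
    apply C_differentiable_mult;
      [apply C_differentiable_const | apply C_differentiable_id]. }
  assert (EF : Re (F zeta) = Cmod (f zeta - zeta)).
  { unfold F. replace (f zeta + - (1) * zeta)%C with (f zeta - zeta)%C by ring.
    rewrite Ec. reflexivity. }
  pose proof (poisson_formula F r zeta ltac:(lra) ltac:(lra)
    (fun z Hz => C_differentiable_continuous F z (HF z Hz))
    (fun z Hz => HF z (proj2 Hz))) as P.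
  rewrite EF in P.
  pose proof (mean_defect_small f r delta Hf Hr Hrd H0 H1) as M.
  assert (Id : ex_RInt (fun th => defect f (circle_point r th)) 0 (2 * PI))
    by (apply ex_RInt_defect; auto; lra).
  assert (U : RInt (fun th => poisson r zeta (circle_point r th)
                              * Re (F (circle_point r th))) 0 (2 * PI)
    <= RInt (fun th => 4 / eta * (a / 2) + 4 / (eta * a) * defect f (circle_point r th))
         0 (2 * PI)).
  { apply RInt_le; [lra | | |].
    - apply (ex_RInt_poisson_mult r _ (fun th => Re (F (circle_point r th)))); try lra.
      intros th. apply continuous_circle_point_Re, C_differentiable_continuous, HF.
      rewrite Cmod_circle_point; lra.
    - apply ex_RInt_Rplus; [apply ex_RInt_const|].
      apply ex_RInt_Rmult_const. exact Id.
    - intros th _.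
      assert (Hm : Cmod (circle_point r th) = r) by (apply Cmod_circle_point; lra).
      set (z := circle_point r th) in *.
      destruct (poisson_bounds r zeta z ltac:(lra) ltac:(lra) Hm) as [B1 B2].
      assert (B1' : 0 <= poisson r zeta z).
      { eapply Rle_trans; [|exact B1]. apply Rdiv_le_0_compat.
        - lra.
        - pose proof (Cmod_ge_0 zeta). lra. }
      assert (B2' : poisson r zeta z <= 4 / eta).
      { eapply Rle_trans; [exact B2|].
        replace (4 / eta) with (2 * / (eta / 2)) by (field; lra).
        pose proof (Cmod_ge_0 zeta).
        apply Rmult_le_compat; [lra | | lra |].
        - left. apply Rinv_0_lt_compat. lra.
        - apply Rinv_le_contravar; lra. }
      (* Young's inequality replaces the square of the displacement, which the
         defect controls, by the displacement itself. *)
      assert (Y : Re (F z) <= a / 2 + defect f z / a).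
      { assert (T : Re (F z) <= Cmod (f z - z)).
        { eapply Rle_trans; [apply Re_bounds|]. unfold F.
          replace (f z + - (1) * z)%C with (f z - z)%C by ring.
          rewrite Cmod_mult, Hc. lra. }
        pose proof (defect_lower_bound f z Hf ltac:(lra)) as D.
        pose proof (pow2_ge_0 (Cmod (f z - z) - a)).
        apply (Rmult_le_reg_r a); [exact Ha|].
        replace ((a / 2 + defect f z / a) * a) with (a ^ 2 / 2 + defect f z)
          by (field; lra).
        nra. }
      assert (Y0 : 0 <= a / 2 + defect f z / a).
      { apply Rplus_le_le_0_compat; [lra|]. apply Rdiv_le_0_compat; [|exact Ha].
        apply defect_ge_0; auto; lra. }
      apply Rle_trans with (poisson r zeta z * (a / 2 + defect f z / a)).
      { apply Rmult_le_compat_l; assumption. }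
      apply Rle_trans with (4 / eta * (a / 2 + defect f z / a)).
      { apply Rmult_le_compat_r; assumption. }
      right. field. lra. }
  rewrite P in U.
  rewrite (RInt_Rplus (fun _ => 4 / eta * (a / 2))
    (fun th => 4 / (eta * a) * defect f (circle_point r th)) 0 (2 * PI)
    (ex_RInt_const _ _ _) (ex_RInt_Rmult_const _ _ _ _ Id)) in U.
  rewrite RInt_Rconst in U.
  rewrite (RInt_Rmult_const (4 / (eta * a)) _ _ _ Id) in U.
  assert (K : 4 / (eta * a) * RInt (fun th => defect f (circle_point r th)) 0 (2 * PI)
    <= 4 / (eta * a) * (2 * PI * (30 * delta))).
  { apply Rmult_le_compat_l; [|exact M]. apply Rdiv_le_0_compat; [lra|].
    apply Rmult_lt_0_compat; lra. }
  apply (Rmult_le_reg_l (2 * PI)); [lra|].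
  replace (2 * PI * (4 / eta * (a / 2 + 30 * delta / a)))
    with (4 / eta * (a / 2) * (2 * PI - 0)
          + 4 / (eta * a) * (2 * PI * (30 * delta))) by (field; lra).
  lra.
Qed.

Lemma poisson_numerator_bound (r p q A B e : R) :
  r <= 1 -> 0 <= p <= r -> 0 <= q <= r -> 0 <= A <= 2 -> 0 <= B <= 2 ->
  Rabs (p - q) <= e -> Rabs (B - A) <= e ->
  Rabs ((r ^ 2 - p ^ 2) * ((B - A) * (B + A)) - (p - q) * (p + q) * A ^ 2)
    <= 12 * e.
Proof.
  intros Hr Hp Hq HA HB Hpq HAB.
  assert (0 <= r ^ 2 - p ^ 2 <= 1).
  { pose proof (pow_incr p r 2 Hp). pose proof (pow2_ge_0 p).
    pose proof (pow_incr r 1 2 ltac:(lra)). lra. }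
  assert (0 <= A ^ 2 <= 4).
  { pose proof (pow2_ge_0 A). pose proof (pow_incr A 2 2 HA). lra. }
  eapply Rle_trans; [apply Rabs_triang|]. rewrite Rabs_Ropp.
  rewrite !Rabs_mult.
  rewrite (Rabs_pos_eq (B + A)), (Rabs_pos_eq (p + q)),
    (Rabs_pos_eq (A ^ 2)), (Rabs_pos_eq (r ^ 2 - p ^ 2)) by lra.
  pose proof (Rabs_pos (B - A)). pose proof (Rabs_pos (p - q)).
  assert (T1 : (r ^ 2 - p ^ 2) * (Rabs (B - A) * (B + A)) <= 1 * (e * 4)).
  { apply Rmult_le_compat; try lra; [apply Rmult_le_pos; lra|].
    apply Rmult_le_compat; lra. }
  assert (T2 : Rabs (p - q) * (p + q) * A ^ 2 <= e * 2 * 4).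
  { apply Rmult_le_compat; try lra; [apply Rmult_le_pos; lra|].
    apply Rmult_le_compat; lra. }
  lra.
Qed.

Lemma poisson_lipschitz (r rho : R) (z a b : C) :
  0 <= rho < r -> r < 1 -> Cmod z = r -> Cmod a <= rho -> Cmod b <= rho ->
  Rabs (poisson r a z - poisson r b z) <= 12 / (r - rho) ^ 4 * Cmod (a - b).
Proof.
  intros Hrho Hr Hz Ha Hb.
  pose proof (Cmod_ge_0 a). pose proof (Cmod_ge_0 b).
  assert (D1 : Rabs (Cmod a - Cmod b) <= Cmod (a - b)) by apply Cmod_triangle_inv.
  assert (D2 : Rabs (Cmod (z - b) - Cmod (z - a)) <= Cmod (a - b)).
  { eapply Rle_trans; [apply Cmod_triangle_inv|]. right. f_equal. ring. }
  assert (A1 : r - rho <= Cmod (z - a) <= 2).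
  { pose proof (Cmod_triangle_inv z a) as T. apply Rabs_le_between in T.
    pose proof (Cmod_triangle z (- a)) as T2. rewrite Cmod_opp in T2.
    unfold Cminus in *. lra. }
  assert (B1 : r - rho <= Cmod (z - b) <= 2).
  { pose proof (Cmod_triangle_inv z b) as T. apply Rabs_le_between in T.
    pose proof (Cmod_triangle z (- b)) as T2. rewrite Cmod_opp in T2.
    unfold Cminus in *. lra. }
  unfold poisson.
  set (A := Cmod (z - a)) in *. set (B := Cmod (z - b)) in *.
  set (p := Cmod a) in *. set (q := Cmod b) in *. set (e := Cmod (a - b)) in *.
  replace ((r ^ 2 - p ^ 2) / A ^ 2 - (r ^ 2 - q ^ 2) / B ^ 2)
    with (((r ^ 2 - p ^ 2) * ((B - A) * (B + A)) - (p - q) * (p + q) * A ^ 2)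
          * / (A ^ 2 * B ^ 2)) by (field; lra).
  rewrite Rabs_mult.
  assert (P0 : 0 < (r - rho) ^ 4) by (apply pow_lt; lra).
  assert (P1 : (r - rho) ^ 4 <= A ^ 2 * B ^ 2).
  { replace ((r - rho) ^ 4) with ((r - rho) ^ 2 * (r - rho) ^ 2) by ring.
    apply Rmult_le_compat; try apply pow2_ge_0; apply pow_incr; lra. }
  replace (12 / (r - rho) ^ 4 * e) with (12 * e * / (r - rho) ^ 4)
    by (field; lra).
  apply Rmult_le_compat; try apply Rabs_pos.
  - apply poisson_numerator_bound; lra.
  - rewrite Rabs_pos_eq.
    + apply Rinv_le_contravar; assumption.
    + left. apply Rinv_0_lt_compat. lra.
Qed.

(** The Poisson kernel is Lipschitz in [zeta], uniformly on a smaller disk, and all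
    self-maps of the disk have the same bound. *)
Lemma disk_map_equilipschitz (rho : R) :
  0 <= rho < 1 -> exists L, 0 < L /\
  forall f a b, disk_map f -> Cmod a <= rho -> Cmod b <= rho ->
    Cmod (f a - f b) <= L * Cmod (a - b).
Proof.
  intros Hrho. set (r := (1 + rho) / 2).
  assert (Hr : 0 < r < 1 /\ rho < r) by (unfold r; lra).
  exists (12 / (r - rho) ^ 4).
  assert (HL : 0 < 12 / (r - rho) ^ 4).
  { apply Rdiv_lt_0_compat; [lra|]. apply pow_lt; lra. }
  split; [exact HL|].
  intros f a b Hf Ha Hb. pose proof PI_RGT_0.
  destruct (Cmod_rotation (f a - f b)) as (c & Hc & Ec).
  pose (F := fun z => (c * f z)%C).
  assert (HF : forall z, Cmod z <= r -> C_differentiable F z).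
  { intros z Hz. apply C_differentiable_mult; [apply C_differentiable_const|].
    apply (proj1 Hf); lra. }
  assert (I : forall w, Cmod w <= rho ->
    ex_RInt (fun th => poisson r w (circle_point r th) * Re (F (circle_point r th)))
      0 (2 * PI)).
  { intros w Hw.
    apply (ex_RInt_poisson_mult r w (fun th => Re (F (circle_point r th)))); try lra.
    intros th. apply continuous_circle_point_Re, C_differentiable_continuous, HF.
    rewrite Cmod_circle_point; lra. }
  assert (P : forall w, Cmod w <= rho ->
    RInt (fun th => poisson r w (circle_point r th) * Re (F (circle_point r th))) 0 (2 * PI)
    = 2 * PI * Re (F w)).
  { intros w Hw. apply poisson_formula; try lra.
    - intros z Hz. apply C_differentiable_continuous, HF, Hz.
    - intros z Hz. apply HF; lra. }
  pose proof (RInt_near_const (fun th =>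
    poisson r a (circle_point r th) * Re (F (circle_point r th))
    - poisson r b (circle_point r th) * Re (F (circle_point r th))) 0 (2 * PI) 0
    (12 / (r - rho) ^ 4 * Cmod (a - b)) ltac:(lra)
    (ex_RInt_Rminus _ _ _ _ (I a Ha) (I b Hb))) as K.
  rewrite RInt_Rminus, (P a Ha), (P b Hb), Rmult_0_l, !Rminus_0_r in K by auto.
  assert (E : Re (F a) - Re (F b) = Cmod (f a - f b)).
  { assert (E' : (F a - F b = RtoC (Cmod (f a - f b)))%C)
      by (rewrite <- Ec; unfold F; ring).
    change (Re (F a - F b)%C = Cmod (f a - f b)). rewrite E'. reflexivity. }
  rewrite <- Rmult_minus_distr_l, E in K.
  rewrite Rabs_pos_eq in K
    by (apply Rmult_le_pos; [lra | apply Cmod_ge_0]).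
  apply (Rmult_le_reg_l (2 * PI)); [lra|].
  rewrite (Rmult_comm (2 * PI) (_ * _)). apply K.
  intros th _. rewrite Rminus_0_r, <- Rmult_minus_distr_r, Rabs_mult.
  assert (Hm : Cmod (circle_point r th) = r) by (apply Cmod_circle_point; lra).
  assert (Q : Rabs (Re (F (circle_point r th))) <= 1).
  { eapply Rle_trans; [apply re_le_Cmod|]. unfold F.
    rewrite Cmod_mult, Hc, Rmult_1_l. left. apply (proj2 Hf). lra. }
  pose proof (poisson_lipschitz r rho (circle_point r th) a b ltac:(lra) ltac:(lra)
    Hm Ha Hb) as PL.
  apply Rle_trans with (12 / (r - rho) ^ 4 * Cmod (a - b) * 1); [|lra].
  apply Rmult_le_compat; try apply Rabs_pos; assumption.
Qed.

(** * The maximal inequality *)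

Lemma ex_RInt_continuous_all (v : R -> R) (a b : R) :
  (forall x, continuous v x) -> ex_RInt v a b.
Proof.
  intros Hv. apply (ex_RInt_continuous (V := R_CompleteNormedModule)).
  intros x _. apply Hv.
Qed.

Lemma RInt_ext_pointwise (f g : R -> R) (a b : R) :
  (forall x, f x = g x) -> RInt f a b = RInt g a b.
Proof. intros H. apply RInt_ext. intros x _. apply H. Qed.

Lemma RInt_Chasles_continuous (v : R -> R) (a b c : R) :
  (forall x, continuous v x) -> RInt v a c = RInt v a b + RInt v b c.
Proof.
  intros Hv. symmetry. apply (RInt_Chasles v);
    apply ex_RInt_continuous_all; exact Hv.
Qed.

Lemma RInt_nonneg (v : R -> R) (a b : R) :
  a <= b -> (forall x, continuous v x) -> (forall x, 0 <= v x) ->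
  0 <= RInt v a b.
Proof.
  intros Hab Hv H0. apply RInt_ge_0; auto.
  apply ex_RInt_continuous_all; exact Hv.
Qed.

Lemma RInt_shift (v : R -> R) (a b s : R) :
  (forall x, continuous v x) ->
  RInt (fun x => v (s + x)) a b = RInt v (s + a) (s + b).
Proof.
  intros Hv.
  pose proof (RInt_comp_lin v 1 s a b
    (ex_RInt_continuous_all v _ _ Hv)) as E.
  rewrite !Rmult_1_l, !(Rplus_comm _ s) in E. rewrite <- E.
  apply RInt_ext_pointwise. intros x.
  change (v (s + x) = 1 * v (1 * x + s)). rewrite !Rmult_1_l, Rplus_comm. reflexivity.
Qed.

Lemma RInt_reflect (v : R -> R) (a b s : R) :
  (forall x, continuous v x) ->
  RInt (fun x => v (s - x)) a b = RInt v (s - b) (s - a).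
Proof.
  intros Hv.
  pose proof (RInt_comp_lin v (-1) s a b
    (ex_RInt_continuous_all v _ _ Hv)) as E.
  rewrite <- (opp_RInt_swap v) by (apply ex_RInt_continuous_all; exact Hv).
  replace (s - a) with (-1 * a + s) by ring.
  replace (s - b) with (-1 * b + s) by ring.
  rewrite <- E.
  rewrite <- (RInt_opp (V := R_CompleteNormedModule)).
  - apply RInt_ext_pointwise. intros x.
    change (v (s - x) = - (-1 * v (-1 * x + s))).
    replace (-1 * x + s) with (s - x) by ring. ring.
  - apply (ex_RInt_comp_lin v (-1) s a b).
    apply ex_RInt_continuous_all; exact Hv.
Qed.

Lemma continuous_shift (v : R -> R) (s : R) :
  (forall x, continuous v x) -> forall x, continuous (fun x => v (s + x)) x.
Proof.
  intros Hv x. apply (continuous_comp (fun x => s + x) v); [|apply Hv].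
  apply (continuous_plus (V := R_NormedModule));
    [apply continuous_const | apply continuous_id].
Qed.

Lemma continuous_reflect (v : R -> R) (s : R) :
  (forall x, continuous v x) -> forall x, continuous (fun x => v (s - x)) x.
Proof.
  intros Hv x. apply (continuous_comp (fun x => s - x) v); [|apply Hv].
  apply (continuous_minus (V := R_NormedModule));
    [apply continuous_const | apply continuous_id].
Qed.

Lemma RInt_fold (v : R -> R) (s X : R) :
  (forall x, continuous v x) ->
  RInt v (s - X) (s + X) = RInt (fun x => v (s + x) + v (s - x)) 0 X.
Proof.
  intros Hv. rewrite RInt_Rplus.
  - rewrite RInt_shift, RInt_reflect by exact Hv.
    rewrite Rplus_0_r, Rminus_0_r, (RInt_Chasles_continuous v (s - X) s) by exact Hv.
    apply Rplus_comm.
  - apply ex_RInt_continuous_all, continuous_shift, Hv.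
  - apply ex_RInt_continuous_all, continuous_reflect, Hv.
Qed.

Lemma RInt_periodic (v : R -> R) (a T : R) :
  (forall x, continuous v x) -> (forall x, v (T + x) = v x) ->
  RInt v a (a + T) = RInt v 0 T.
Proof.
  intros Hv HT.
  rewrite (RInt_Chasles_continuous v a 0 (a + T) Hv).
  rewrite (RInt_Chasles_continuous v 0 T (a + T) Hv).
  assert (E : RInt v T (a + T) = RInt v 0 a).
  { pose proof (RInt_shift v 0 a T Hv) as S.
    rewrite Rplus_0_r, (Rplus_comm T a) in S. rewrite <- S.
    apply RInt_ext_pointwise. intros x. apply HT. }
  rewrite E, <- (opp_RInt_swap v 0 a).
  - change (- RInt v 0 a + (RInt v 0 T + RInt v 0 a) = RInt v 0 T). ring.
  - apply ex_RInt_continuous_all; exact Hv.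
Qed.

Lemma is_derive_RInt_continuous (v : R -> R) (a x : R) :
  (forall x, continuous v x) -> is_derive (fun y => RInt v a y) x (v x).
Proof.
  intros Hv. apply (is_derive_RInt v (fun y => RInt v a y) a x).
  - apply filter_forall. intros y. apply (RInt_correct v).
    apply ex_RInt_continuous_all; exact Hv.
  - apply Hv.
Qed.

Lemma nondecreasing_of_derivative (D d : R -> R) (a b : R) :
  a <= b -> (forall x, is_derive D x (d x)) ->
  (forall x, a <= x <= b -> 0 <= d x) -> D a <= D b.
Proof.
  intros Hab HD Hd.
  destruct (MVT_gen D a b d) as (c & Hc & E).
  - intros x _. apply HD.
  - intros x _. apply continuity_pt_filterlim.
    apply (ex_derive_continuous (K := R_AbsRing) (V := R_NormedModule)).
    exists (d x). apply HD.
  - rewrite Rmin_left, Rmax_right in Hc by assumption.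
    specialize (Hd c Hc). nra.
Qed.

(** A decreasing kernel is a superposition of indicators of intervals [[0, x]], on
    each of which the mean of [w] is at most [lambda]. The superposition appears
    as an integration by parts: the difference [D] below of the integrated and
    the boundary terms is nondecreasing. *)
Lemma decreasing_kernel_average (K dK w : R -> R) (lambda X : R) :
  0 <= X ->
  (forall x, is_derive K x (dK x)) ->
  (forall x, 0 <= x <= X -> dK x <= 0) -> (forall x, 0 <= K x) ->
  (forall x, continuous w x) ->
  (forall x, 0 <= x <= X -> RInt w 0 x <= lambda * x) ->
  RInt (fun x => K x * w x) 0 X <= lambda * RInt K 0 X.
Proof.
  intros HX HK HKneg HKpos Hw Havg.
  assert (CK : forall x, continuous K x).
  { intros x. apply (ex_derive_continuous (K := R_AbsRing) (V := R_NormedModule)).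
    exists (dK x). apply HK. }
  assert (Cg : forall x, continuous (fun y => K y * (lambda - w y)) x).
  { intros x. apply (continuous_mult (K := R_AbsRing)); [apply CK|].
    apply (continuous_minus (V := R_NormedModule)); [apply continuous_const | apply Hw]. }
  assert (CKw : forall x, continuous (fun y => K y * w y) x).
  { intros x. apply (continuous_mult (K := R_AbsRing)); [apply CK | apply Hw]. }
  set (D := fun x => RInt (fun y => K y * (lambda - w y)) 0 x
                     - K x * (lambda * x - RInt w 0 x)).
  assert (HD : D 0 <= D X).
  { apply (nondecreasing_of_derivative D
      (fun x => - dK x * (lambda * x - RInt w 0 x))); [exact HX| |].
    - intros x. unfold D.
      assert (Did : is_derive (fun x => lambda * x) x lambda)
        by (auto_derive; [exact I | apply Rmult_1_r]).
      assert (Dl : is_derive (fun x => lambda * x - RInt w 0 x) x (lambda - w x)).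
      { apply (is_derive_minus (K := R_AbsRing) (V := R_NormedModule)).
        - exact Did.
        - apply is_derive_RInt_continuous; exact Hw. }
      pose proof (is_derive_mult K _ x _ _ (HK x) Dl Rmult_comm) as Dm.
      pose proof (is_derive_minus (K := R_AbsRing) (V := R_NormedModule) _ _ x _ _
        (is_derive_RInt_continuous _ 0 x Cg) Dm) as Dd.
      eapply is_derive_ext; [|eapply eq_rect; [exact Dd|]].
      + intros t. reflexivity.
      + change (K x * (lambda - w x)
          - (dK x * (lambda * x - RInt w 0 x) + K x * (lambda - w x))
          = - dK x * (lambda * x - RInt w 0 x)). ring.
    - intros x Hx. specialize (Havg x Hx). specialize (HKneg x Hx). nra. }
  unfold D in HD. rewrite !RInt_point in HD.
  change (zero - K 0 * (lambda * 0 - zero)) with (0 - K 0 * (lambda * 0 - 0)) in HD.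
  assert (E : RInt (fun y => K y * (lambda - w y)) 0 X
    = lambda * RInt K 0 X - RInt (fun x => K x * w x) 0 X).
  { rewrite <- RInt_Rmult_const by (apply ex_RInt_continuous_all; exact CK).
    rewrite <- RInt_Rminus.
    - apply RInt_ext_pointwise. intros x. ring.
    - apply ex_RInt_Rmult_const, ex_RInt_continuous_all, CK.
    - apply ex_RInt_continuous_all, CKw. }
  rewrite E in HD. specialize (Havg X ltac:(lra)). specialize (HKpos X).
  nra.
Qed.

Lemma poisson_polar (r rho theta x : R) :
  0 <= rho -> 0 < r ->
  poisson r (circle_point rho theta) (circle_point r (theta + x))
  = (r ^ 2 - rho ^ 2) / (r ^ 2 + rho ^ 2 - 2 * r * rho * cos x).
Proof.
  intros Hrho Hr. unfold poisson. rewrite Cmod_circle_point by assumption. f_equal.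
  rewrite Cmod2_alt. unfold circle_point, Re, Im; simpl.
  replace (cos x) with (cos (theta + x - theta)) by (f_equal; ring).
  rewrite cos_minus.
  pose proof (sin2_cos2 theta) as E1. pose proof (sin2_cos2 (theta + x)) as E2.
  unfold Rsqr in E1, E2.
  set (c := cos theta) in *. set (s := sin theta) in *.
  set (c' := cos (theta + x)) in *. set (s' := sin (theta + x)) in *.
  replace (r * (r * 1) + rho * (rho * 1))
    with (r * r * (s' * s' + c' * c') + rho * rho * (s * s + c * c))
    by (rewrite E1, E2; ring).
  ring.
Qed.

Lemma poisson_denominator_pos (r rho x : R) :
  0 <= rho < r -> 0 < r ^ 2 + rho ^ 2 - 2 * r * rho * cos x.
Proof.
  intros H. pose proof (COS_bound x).
  assert (0 <= 2 * r * rho) by nra.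
  assert (0 < (r - rho) ^ 2) by (apply pow_lt; lra).
  nra.
Qed.

(** If all averages of [v] over intervals centred at [theta] were below [lambda], so
    would be the Poisson integral at any point of angle [theta], because the
    Poisson kernel is even and decreasing in the angular distance. *)
Lemma poisson_maximal (v : R -> R) (r rho theta lambda : R) :
  0 <= rho < r ->
  (forall x, continuous v x) -> (forall x, v (2 * PI + x) = v x) ->
  2 * PI * lambda <
    RInt (fun th => poisson r (circle_point rho theta) (circle_point r th) * v th)
      0 (2 * PI) ->
  exists x, 0 < x <= PI /\
    lambda * (2 * x) <= RInt v (theta - x) (theta + x).
Proof.
  intros Hrho Hv Hper Hlt. pose proof PI_RGT_0 as HPI.
  apply NNPP. intros Hno.
  set (K := fun x => (r ^ 2 - rho ^ 2) / (r ^ 2 + rho ^ 2 - 2 * r * rho * cos x)).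
  set (dK := fun x => - ((r ^ 2 - rho ^ 2) * (2 * r * rho * sin x))
                      / (r ^ 2 + rho ^ 2 - 2 * r * rho * cos x) ^ 2).
  assert (HK : forall x, is_derive K x (dK x)).
  { intros x. unfold K, dK. pose proof (poisson_denominator_pos r rho x Hrho).
    auto_derive; [lra|]. field. lra. }
  assert (CK : forall x, continuous K x).
  { intros x. apply (ex_derive_continuous (K := R_AbsRing) (V := R_NormedModule)).
    exists (dK x). apply HK. }
  assert (K0 : forall x, 0 <= K x).
  { intros x. apply Rdiv_le_0_compat; [|apply poisson_denominator_pos, Hrho].
    nra. }
  assert (Keven : forall x, K (- x) = K x).
  { intros x. unfold K. rewrite cos_neg. reflexivity. }
  set (g := fun th => poisson r (circle_point rho theta) (circle_point r th) * v th).
  assert (Cg : forall x, continuous g x).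
  { intros x. apply (continuous_mult (K := R_AbsRing)); [|apply Hv].
    apply poisson_continuous; [lra|]. rewrite Cmod_circle_point; lra. }
  assert (Eg : forall x, g (theta + x) = K x * v (theta + x)).
  { intros x. unfold g. rewrite poisson_polar by lra. reflexivity. }
  set (w := fun x => v (theta + x) + v (theta - x)).
  assert (Cw : forall x, continuous w x).
  { intros x. apply (continuous_plus (V := R_NormedModule)).
    - apply continuous_shift, Hv.
    - apply continuous_reflect, Hv. }
  assert (Ew : forall x, RInt w 0 x = RInt v (theta - x) (theta + x)).
  { intros x. symmetry. apply RInt_fold, Hv. }
  assert (Eint : RInt g 0 (2 * PI) = RInt (fun x => K x * w x) 0 PI).
  { rewrite <- (RInt_periodic g (theta - PI) (2 * PI) Cg).
    - replace (theta - PI + 2 * PI) with (theta + PI) by ring.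
      rewrite (RInt_fold g theta PI Cg). apply RInt_ext_pointwise. intros x.
      pose proof (Eg (- x)) as En.
      change (theta + - x) with (theta - x) in En.
      rewrite Eg, En, Keven. unfold w. ring.
    - intros x. unfold g. rewrite circle_point_periodic, Hper. reflexivity. }
  set (pk := fun th : R => poisson r (circle_point rho theta) (circle_point r th)).
  assert (Cp : forall x, continuous pk x).
  { intros x. apply poisson_continuous; [lra|]. rewrite Cmod_circle_point; lra. }
  assert (EK : 2 * RInt K 0 PI = 2 * PI).
  { transitivity (RInt pk 0 (2 * PI)).
    - rewrite <- (RInt_periodic pk (theta - PI) (2 * PI) Cp).
      + replace (theta - PI + 2 * PI) with (theta + PI) by ring.
        rewrite (RInt_fold pk theta PI Cp).
        rewrite <- RInt_Rmult_const by (apply ex_RInt_continuous_all, CK).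
        apply RInt_ext_pointwise. intros x. unfold pk.
        pose proof (poisson_polar r rho theta (- x) ltac:(lra) ltac:(lra)) as En.
        change (theta + - x) with (theta - x) in En.
        rewrite En, poisson_polar by lra. rewrite cos_neg. unfold K. ring.
      + intros x. unfold pk. rewrite circle_point_periodic. reflexivity.
    - apply RInt_poisson; [lra|]. rewrite Cmod_circle_point; lra. }
  fold g in Hlt.
  assert (Hmax : RInt (fun x => K x * w x) 0 PI <= 2 * lambda * RInt K 0 PI).
  { apply (decreasing_kernel_average K dK); auto; [lra| |].
    - intros x Hx. unfold dK.
      pose proof (poisson_denominator_pos r rho x Hrho) as P.
      pose proof (sin_ge_0 x ltac:(lra) ltac:(lra)) as S.
      assert (0 <= (r ^ 2 - rho ^ 2) * (2 * r * rho * sin x)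
                 / (r ^ 2 + rho ^ 2 - 2 * r * rho * cos x) ^ 2).
      { apply Rdiv_le_0_compat; [|apply pow_lt; exact P].
        apply Rmult_le_pos; [nra|]. apply Rmult_le_pos; nra. }
      unfold Rdiv in *. lra.
    - intros x Hx. destruct (Req_dec x 0) as [->|N].
      + rewrite RInt_point. change zero with 0. lra.
      + rewrite Ew. apply Rnot_lt_le. intros Hc. apply Hno.
        exists x. split; [lra|]. lra. }
  rewrite Eint in Hlt.
  assert (2 * lambda * RInt K 0 PI = 2 * PI * lambda) by (rewrite <- EK; ring).
  lra.
Qed.

Lemma list_maximum {A : Type} (h : A -> R) (P : A -> Prop) (L : list A) :
  (exists i, In i L /\ P i) ->
  exists i, In i L /\ P i /\ forall j, In j L -> P j -> h j <= h i.
Proof.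
  induction L as [|x L IH]; intros (i & Hi & HPi); [destruct Hi|].
  destruct (classic (exists j, In j L /\ P j)) as [Hex|Hno].
  - destruct (IH Hex) as (m & Hm & HPm & Hmax).
    destruct (classic (P x /\ h m < h x)) as [[HPx Hlt]|Hn].
    + exists x. split; [left; reflexivity|]. split; [exact HPx|].
      intros j [<-|Hj] HPj; [lra|]. specialize (Hmax j Hj HPj). lra.
    + exists m. split; [right; exact Hm|]. split; [exact HPm|].
      intros j [<-|Hj] HPj; [|apply Hmax; assumption].
      apply Rnot_lt_le. intros Hlt. apply Hn. split; assumption.
  - destruct Hi as [<-|Hi]; [|elim Hno; exists i; split; assumption].
    exists x. split; [left; reflexivity|]. split; [exact HPi|].
    intros j [<-|Hj] HPj; [lra|]. elim Hno. exists j. split; assumption.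
Qed.

Section Covering.

Variables (F : R -> R) (lambda p q : R).
Hypothesis HF : forall x y, x <= y -> F x <= F y.
Hypothesis Hlambda : 0 <= lambda.

(** The function [F] stands for an antiderivative of a nonnegative function, whose
    mass on an interval is the increment of [F]. *)
Definition heavy (i : R * R) : Prop :=
  p <= fst i /\ fst i < snd i /\ snd i <= q /\
  lambda * (snd i - fst i) <= F (snd i) - F (fst i).

(** Compactness of [[a, b]], by the supremum of the points up to which a finite
    cover exists. *)
Lemma heavy_finite_cover (a b : R) :
  a <= b ->
  (forall t, a <= t <= b -> exists i, heavy i /\ fst i < t < snd i) ->
  exists L, (forall i, In i L -> heavy i) /\
    forall t, a <= t <= b -> exists i, In i L /\ fst i < t < snd i.
Proof.
  intros Hab Hcov.
  set (S := fun y => a <= y <= b /\ exists L, (forall i, In i L -> heavy i) /\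
    forall t, a <= t <= y -> exists i, In i L /\ fst i < t < snd i).
  destruct (completeness S) as [s [Hub Hlub]].
  - exists b. intros y [Hy _]. lra.
  - exists a. split; [lra|]. destruct (Hcov a ltac:(lra)) as (i & Hi & Hai).
    exists (i :: nil). split.
    + intros j [<-|[]]. exact Hi.
    + intros t Ht. exists i. split; [left; reflexivity|]. lra.
  - assert (Hsb : s <= b) by (apply Hlub; intros y [Hy _]; lra).
    assert (Has : a <= s).
    { apply Hub. split; [lra|]. destruct (Hcov a ltac:(lra)) as (i & Hi & Hai).
      exists (i :: nil). split.
      + intros j [<-|[]]. exact Hi.
      + intros t Ht. exists i. split; [left; reflexivity|]. lra. }
    destruct (Hcov s ltac:(lra)) as (i & Hi & Hsi).
    assert (Hy : exists y, S y /\ fst i < y).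
    { apply NNPP. intros Hn. assert (s <= fst i); [|lra].
      apply Hlub. intros y Hy. apply Rnot_lt_le. intros Hlt.
      apply Hn. exists y. split; assumption. }
    destruct Hy as (y & (Hy & L & HL & HLc) & Hiy).
    assert (Hext : forall z, z < snd i -> forall t, a <= t <= z ->
      exists j, In j (i :: L) /\ fst j < t < snd j).
    { intros z Hz t Ht. destruct (Rle_dec t y) as [H|H].
      - destruct (HLc t ltac:(lra)) as (j & Hj & Hjt).
        exists j. split; [right; exact Hj | exact Hjt].
      - exists i. split; [left; reflexivity | lra]. }
    assert (HL' : forall j, In j (i :: L) -> heavy j).
    { intros j [<-|Hj]; [exact Hi | apply HL, Hj]. }
    destruct (Rlt_dec b (snd i)) as [Hb|Hb].
    + exists (i :: L). split; [exact HL' | apply Hext; exact Hb].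
    + exfalso. assert ((s + snd i) / 2 <= s); [|lra].
      apply Hub. split; [lra|]. exists (i :: L). split; [exact HL'|].
      apply Hext. lra.
Qed.

(** From left to right, choose among the intervals that contain the current end
    point [e] the one that reaches furthest. It does not start before the previous
    end point [e'], or it would have been chosen before; so every point is covered
    at most twice, which is the origin of the factor 2. The quantity
    [F e + F e' - 2 * F p] bounds the mass used so far, counted with its
    multiplicity. *)
Lemma heavy_cover_bound (a b : R) :
  p <= a -> a <= b -> b <= q ->
  (forall t, a <= t <= b -> exists i, heavy i /\ fst i < t < snd i) ->
  lambda * (b - a) <= 2 * (F q - F p).
Proof.
  intros Hpa Hab Hbq Hcov.
  destruct (heavy_finite_cover a b Hab Hcov) as (L & HL & HLc).
  set (Inv := fun e => a <= e <= q /\ exists e', p <= e' <= e /\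
    lambda * (e - a) <= F e + F e' - 2 * F p /\
    forall i, In i L -> fst i < e' < snd i -> snd i <= e).
  destruct (list_maximum (fun e : R => e) Inv (a :: map snd L))
    as (e & _ & (Hae & e' & He' & Hlen & Hmaxr) & Hmax).
  { exists a. split; [left; reflexivity|]. split; [lra|]. exists p.
    split; [lra|]. split.
    - rewrite Rminus_diag, Rmult_0_r. pose proof (HF p a Hpa). lra.
    - intros i Hi Hc. destruct (HL i Hi) as [Hp _]. lra. }
  destruct (Rlt_dec b e) as [Hbe|Hbe].
  { pose proof (HF e q ltac:(lra)). pose proof (HF e' q ltac:(lra)).
    assert (lambda * (b - a) <= lambda * (e - a))
      by (apply Rmult_le_compat_l; lra).
    lra. }
  exfalso.
  destruct (list_maximum snd (fun i => fst i < e < snd i) L)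
    as (i & Hi & Hie & Himax).
  { destruct (HLc e ltac:(lra)) as (i & Hi & Hie). exists i. split; assumption. }
  destruct (HL i Hi) as (H1 & H2 & H3 & H4).
  assert (Hfst : e' <= fst i).
  { apply Rnot_lt_le. intros Hlt. specialize (Hmaxr i Hi ltac:(lra)). lra. }
  assert (snd i <= e); [|lra].
  apply Hmax.
  - right. apply in_map. exact Hi.
  - split; [lra|]. exists e. split; [lra|]. split; [|exact Himax].
    pose proof (HF e' (fst i) Hfst).
    assert (lambda * (snd i - e) <= lambda * (snd i - fst i))
      by (apply Rmult_le_compat_l; lra).
    lra.
Qed.

End Covering.

(** The harmonic extension of the defect from the circle is close to the defect
    itself at [zeta]: the two differ by terms of the size of [f 0] and of the
    deviation of [r ^ 2 / Cmod zeta ^ 2] from 1. *)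
Lemma poisson_defect_lower_bound (f : C -> C) (r eta delta : R) (zeta : C) :
  disk_map f -> 3 / 4 <= r < 1 -> eta <= 1 / 4 ->
  1 - eta <= Cmod zeta < r -> Cmod (f 0%C) <= delta ->
  2 * PI * (defect f zeta - 4 * eta - 3 * delta) <=
  RInt (fun th => poisson r zeta (circle_point r th) * defect f (circle_point r th))
    0 (2 * PI).
Proof.
  intros Hf Hr Heta Hz H0. pose proof PI_RGT_0.
  rewrite poisson_defect by (auto; lra).
  apply Rmult_le_compat_l; [lra|].
  assert (Nz : zeta <> 0%C) by (apply Cmod_gt_0; lra).
  assert (Nm : Cmod zeta ^ 2 <> 0) by (apply pow_nonzero; lra).
  set (k := r ^ 2 / Cmod zeta ^ 2).
  set (X := Re (Cconj zeta * f zeta)%C).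
  assert (E : (RtoC (r ^ 2) * ((f zeta - f 0) / zeta) + Cconj (f 0) * zeta
    = RtoC k * (Cconj zeta * f zeta)
      + (Cconj (f 0) * zeta - RtoC k * (Cconj zeta * f 0)))%C).
  { unfold k. rewrite RtoC_div by exact Nm. rewrite <- (Cmod2_RtoC zeta).
    assert (N2 : Cconj zeta <> 0%C).
    { apply Cmod_gt_0. rewrite Cmod_conj. lra. }
    field. split; assumption. }
  rewrite E.
  assert (Hk : 1 <= k <= 1 + 4 * eta).
  { assert (0 < Cmod zeta ^ 2) by (apply pow_lt; lra).
    unfold k. split.
    - apply (Rmult_le_reg_r (Cmod zeta ^ 2)); [lra|].
      unfold Rdiv. rewrite Rmult_assoc, Rinv_l, Rmult_1_r by lra.
      rewrite Rmult_1_l. apply pow_incr; lra.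
    - apply (Rmult_le_reg_r (Cmod zeta ^ 2)); [lra|].
      unfold Rdiv. rewrite Rmult_assoc, Rinv_l, Rmult_1_r by lra.
      assert (A1 : (1 - eta) ^ 2 <= Cmod zeta ^ 2) by (apply pow_incr; lra).
      assert (A2 : r ^ 2 <= 1) by nra.
      assert (0 <= eta) by lra.
      assert (A3 : 1 <= (1 + 4 * eta) * (1 - eta) ^ 2) by nra.
      assert ((1 + 4 * eta) * (1 - eta) ^ 2 <= (1 + 4 * eta) * Cmod zeta ^ 2)
        by (apply Rmult_le_compat_l; lra).
      lra. }
  assert (HX : Rabs X <= 1).
  { unfold X. eapply Rle_trans; [apply re_le_Cmod|].
    rewrite Cmod_mult, Cmod_conj.
    pose proof (proj2 Hf zeta ltac:(lra)). pose proof (Cmod_ge_0 (f zeta)).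
    pose proof (Cmod_ge_0 zeta). nra. }
  apply Rabs_le_between in HX.
  assert (HT1 : Re (Cconj (f 0%C) * zeta)%C <= delta).
  { eapply Rle_trans; [apply Re_bounds|]. rewrite Cmod_mult, Cmod_conj.
    pose proof (Cmod_ge_0 (f 0%C)). nra. }
  assert (HT2 : - (2 * delta) <= Re (RtoC k * (Cconj zeta * f 0))%C).
  { pose proof (Re_bounds (RtoC k * (Cconj zeta * f 0))%C) as B.
    rewrite !Cmod_mult, Cmod_R, Cmod_conj, Rabs_pos_eq in B by lra.
    pose proof (Cmod_ge_0 (f 0%C)).
    assert (k * (Cmod zeta * Cmod (f 0%C)) <= 2 * (1 * delta)).
    { apply Rmult_le_compat; try lra.
      - apply Rmult_le_pos; lra.
      - apply Rmult_le_compat; lra. }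
    lra. }
  assert (ER : Re (RtoC k * (Cconj zeta * f zeta)
      + (Cconj (f 0) * zeta - RtoC k * (Cconj zeta * f 0)))%C
    = k * X + (Re (Cconj (f 0%C) * zeta)%C - Re (RtoC k * (Cconj zeta * f 0))%C)).
  { unfold X. rewrite <- Re_RtoC_mult. unfold Re; simpl. ring. }
  rewrite ER. unfold defect. fold X.
  assert (k * X <= X + 4 * eta).
  { assert ((k - 1) * X <= (k - 1) * 1) by (apply Rmult_le_compat_l; lra).
    lra. }
  lra.
Qed.

(** Every direction in which the defect reaches [c] near the circle is the centre
    of an interval on which the mean of the defect over the circle of radius [r]
    is at least [c / 4], and the total mass is small by [mean_defect_small]. The
    intervals stay within two turns. *)
Lemma defect_arc_bound (f : C -> C) (delta eta c rhomax th1 th2 : R) :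
  disk_map f -> 0 < delta -> eta <= 1 / 4 -> rhomax < 1 -> 0 < c ->
  4 * eta + 3 * delta <= c / 2 ->
  Cmod (f 0%C) <= delta -> Cmod (f (RtoC (1 / 2)) - RtoC (1 / 2)) <= delta ->
  th1 <= th2 <= th1 + 2 * PI ->
  (forall th, th1 <= th <= th2 -> exists rho,
    1 - eta <= rho <= rhomax /\ c <= defect f (circle_point rho th)) ->
  c * (th2 - th1) <= 960 * PI * delta.
Proof.
  intros Hf Hdelta Heta Hrhomax Hc Hsmall H0 H1 Hth Harc.
  pose proof PI_RGT_0 as HPI.
  destruct (exists_radius delta rhomax Hdelta Hrhomax) as (r & Hr & Hrd & Hrr).
  set (v := fun th => defect f (circle_point r th)).
  assert (Cv : forall x, continuous v x).
  { intros x. apply defect_continuous; auto; lra. }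
  assert (v0 : forall x, 0 <= v x).
  { intros x. apply defect_ge_0; auto. rewrite Cmod_circle_point; lra. }
  assert (Pv : forall x, v (2 * PI + x) = v x).
  { intros x. unfold v. rewrite circle_point_periodic. reflexivity. }
  assert (Mv : RInt v 0 (2 * PI) <= 2 * PI * (30 * delta)).
  { apply mean_defect_small; assumption. }
  set (F := fun y : R => RInt v 0 y : R).
  assert (HF : forall x y, RInt v x y = F y - F x).
  { intros x y. pose proof (RInt_Chasles_continuous v 0 x y Cv). unfold F. lra. }
  assert (B : c / 4 * (th2 - th1)
    <= 2 * (F (th1 - PI + 2 * PI + 2 * PI) - F (th1 - PI))).
  { apply (heavy_cover_bound F (c / 4) (th1 - PI) (th1 - PI + 2 * PI + 2 * PI));
      try lra.
    - intros x y Hxy. pose proof (RInt_nonneg v x y Hxy Cv v0) as Hn.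
      rewrite HF in Hn. lra.
    - intros th Hth'. destruct (Harc th Hth') as (rho & Hrho & Hd).
      destruct (poisson_maximal v r rho th (c / 4)) as (x & Hx & Hxv); auto.
      + lra.
      + pose proof (poisson_defect_lower_bound f r eta delta (circle_point rho th) Hf Hr
          Heta ltac:(rewrite Cmod_circle_point; lra) H0) as L.
        eapply Rlt_le_trans; [|exact L].
        apply Rmult_lt_compat_l; lra.
      + exists (th - x, th + x). unfold heavy. simpl.
        rewrite HF in Hxv. repeat split; lra. }
  rewrite <- HF in B.
  rewrite (RInt_Chasles_continuous v _ (th1 - PI + 2 * PI) _ Cv) in B.
  rewrite !(RInt_periodic v _ (2 * PI) Cv Pv) in B.
  lra.
Qed.

(** * Averages of self-maps *)

Fixpoint rsum (x : nat -> R) (n : nat) : R :=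
  match n with O => 0 | S n => rsum x n + x n end.

Fixpoint csum (a : nat -> C) (n : nat) : C :=
  match n with O => 0%C | S n => (csum a n + a n)%C end.

Lemma rsum_le (x y : nat -> R) n :
  (forall k, (k < n)%nat -> x k <= y k) -> rsum x n <= rsum y n.
Proof.
  induction n as [|n IH]; intros H; simpl; [lra|].
  specialize (IH ltac:(intros k Hk; apply H; lia)).
  specialize (H n ltac:(lia)). lra.
Qed.

Lemma rsum_const (c : R) n : rsum (fun _ => c) n = INR n * c.
Proof. induction n as [|n IH]; [simpl; ring|]. rewrite S_INR. simpl. rewrite IH. ring. Qed.

Lemma rsum_plus (x y : nat -> R) n :
  rsum (fun k => x k + y k) n = rsum x n + rsum y n.
Proof. induction n as [|n IH]; simpl; [ring|]. rewrite IH. ring. Qed.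

Lemma rsum_scal (c : R) (x : nat -> R) n :
  rsum (fun k => c * x k) n = c * rsum x n.
Proof. induction n as [|n IH]; simpl; [ring|]. rewrite IH. ring. Qed.

Lemma rsum_nonneg_le (x : nat -> R) n m :
  (forall k, 0 <= x k) -> (n <= m)%nat -> rsum x n <= rsum x m.
Proof.
  intros Hx H. induction H as [|m H IH]; [lra|]. simpl. specialize (Hx m). lra.
Qed.

Lemma rsum_shift_le (x : nat -> R) j n m :
  (forall k, 0 <= x k) -> (n + j <= m)%nat ->
  rsum (fun k => x (k + j)%nat) n <= rsum x m.
Proof.
  intros Hx H. apply Rle_trans with (rsum x (n + j)).
  - clear H. induction n as [|n IH]; simpl.
    + induction j as [|j IHj]; simpl; [lra|]. specialize (Hx j). lra.
    + lra.
  - apply rsum_nonneg_le; assumption.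
Qed.

Lemma Cmod_csum_le (a : nat -> C) n :
  Cmod (csum a n) <= rsum (fun k => Cmod (a k)) n.
Proof.
  induction n as [|n IH]; simpl; [rewrite Cmod_0; lra|].
  eapply Rle_trans; [apply Cmod_triangle|]. lra.
Qed.

Lemma csum_minus_const (a : nat -> C) (w : C) n :
  csum (fun k => a k - w)%C n = (csum a n - RtoC (INR n) * w)%C.
Proof.
  induction n as [|n IH]; [simpl; ring|].
  rewrite S_INR, RtoC_plus. simpl. rewrite IH. ring.
Qed.

Definition average (fs : nat -> C -> C) (n : nat) (z : C) : C :=
  (RtoC (/ INR n) * csum (fun k => fs k z) n)%C.

Section Average.

Variables (fs : nat -> C -> C) (n : nat).
Hypothesis Hn : (0 < n)%nat.
Hypothesis Hfs : forall k, (k < n)%nat -> disk_map (fs k).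

Lemma INR_n_pos : 0 < INR n.
Proof. apply lt_0_INR. exact Hn. Qed.

Lemma average_disk_map : disk_map (average fs n).
Proof.
  pose proof INR_n_pos as Hp. split.
  - intros z Hz. apply C_differentiable_mult; [apply C_differentiable_const|].
    assert (H : forall m, (m <= n)%nat ->
      C_differentiable (fun z => csum (fun k => fs k z) m) z).
    { induction m as [|m IH]; intros Hm; simpl; [apply C_differentiable_const|].
      apply C_differentiable_plus; [apply IH; lia|]. apply Hfs; [lia | exact Hz]. }
    apply H. lia.
  - intros z Hz. unfold average.
    assert (P : 0 < / INR n) by (apply Rinv_0_lt_compat; exact Hp).
    rewrite Cmod_mult, Cmod_R, Rabs_pos_eq by lra.
    apply (Rmult_lt_reg_l (INR n)); [exact Hp|].
    rewrite <- Rmult_assoc, Rinv_r, Rmult_1_l, Rmult_1_r by lra.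
    eapply Rle_lt_trans; [apply Cmod_csum_le|].
    destruct n as [|m]; [lia|]. rewrite S_INR. simpl.
    assert (rsum (fun k => Cmod (fs k z)) m <= rsum (fun _ => 1) m).
    { apply rsum_le. intros k Hk. left. apply Hfs; [lia | exact Hz]. }
    rewrite rsum_const in H.
    pose proof (proj2 (Hfs m ltac:(lia)) z Hz). lra.
Qed.

Lemma average_displacement (z : C) (d : R) :
  (forall k, (k < n)%nat -> Cmod (fs k z - z) <= d) ->
  Cmod (average fs n z - z) <= d.
Proof.
  intros H. pose proof INR_n_pos as Hp.
  assert (P : 0 < / INR n) by (apply Rinv_0_lt_compat; exact Hp).
  assert (E : (average fs n z - z
               = RtoC (/ INR n) * csum (fun k => fs k z - z) n)%C).
  { rewrite csum_minus_const. unfold average.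
    rewrite RtoC_inv by lra. field. intros E; apply RtoC_inj in E; lra. }
  rewrite E, Cmod_mult, Cmod_R, Rabs_pos_eq by lra.
  apply (Rmult_le_reg_l (INR n)); [exact Hp|].
  rewrite <- Rmult_assoc, Rinv_r, Rmult_1_l by lra.
  eapply Rle_trans; [apply Cmod_csum_le|].
  rewrite <- rsum_const. apply rsum_le. exact H.
Qed.

Lemma average_defect (z : C) :
  INR n * defect (average fs n) z = rsum (fun k => defect (fs k) z) n.
Proof.
  pose proof INR_n_pos as Hp.
  assert (H : forall m, rsum (fun k => defect (fs k) z) m
    = INR m - Re (Cconj z * csum (fun k => fs k z) m)%C).
  { induction m as [|m IH]; [simpl; ring|].
    rewrite S_INR. cbn [rsum csum]. rewrite IH. unfold defect, Re; simpl. ring. }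
  rewrite H. unfold defect, average.
  replace (Cconj z * (RtoC (/ INR n) * csum (fun k => fs k z) n))%C
    with (RtoC (/ INR n) * (Cconj z * csum (fun k => fs k z) n))%C by ring.
  rewrite Re_RtoC_mult. field. lra.
Qed.

Lemma average_displacement_sqr (z : C) :
  Cmod z < 1 ->
  rsum (fun k => Cmod (fs k z - z) ^ 2) n <= 2 * (INR n * defect (average fs n) z).
Proof.
  intros Hz. rewrite average_defect, <- rsum_scal. apply rsum_le.
  intros k Hk. apply defect_lower_bound; auto.
Qed.

End Average.

(** * Paths near the circle *)

Definition path_continuous (g : R -> C) : Prop :=
  forall s eps, 0 < eps -> exists delta, 0 < delta /\
    forall u, Rabs (u - s) < delta -> Cmod (g u - g s) < eps.

Lemma path_continuity_pt (g : R -> C) (h : C -> R) :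
  (forall z w, Rabs (h z - h w) <= Cmod (z - w)) ->
  path_continuous g -> continuity (fun s => h (g s)).
Proof.
  intros Hh Hg s eps He. destruct (Hg s eps He) as (d & Hd & H).
  exists d. split; [exact Hd|]. intros u [_ Hu].
  eapply Rle_lt_trans; [apply Hh|]. apply H. exact Hu.
Qed.

Lemma path_comp (g : R -> C) (k : R -> R) :
  path_continuous g -> continuity k -> path_continuous (fun s => g (k s)).
Proof.
  intros Hg Hk s eps He. destruct (Hg (k s) eps He) as (d & Hd & H).
  destruct (Hk s d Hd) as (d' & Hd' & H').
  exists d'. split; [exact Hd'|]. intros u Hu.
  destruct (Req_dec u s) as [->|N].
  - replace (g (k s) - g (k s))%C with (0 : C) by ring. rewrite Cmod_0. exact He.
  - apply H, H'. split; [split; [exact I | auto] | exact Hu].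
Qed.

Lemma first_exit (h : R -> R) (r : R) :
  continuity h -> h 0 <= r -> r <= h 1 ->
  exists b, 0 <= b <= 1 /\ h b = r /\ forall s, 0 <= s <= b -> h s <= r.
Proof.
  intros Hc H0 H1.
  set (S := fun s => 0 <= s <= 1 /\ forall u, 0 <= u <= s -> h u <= r).
  destruct (completeness S) as [b [Hub Hlub]].
  - exists 1. intros s [Hs _]. lra.
  - exists 0. split; [lra|]. intros u Hu. replace u with 0 by lra. exact H0.
  - assert (Hb0 : 0 <= b).
    { apply Hub. split; [lra|]. intros u Hu. replace u with 0 by lra. exact H0. }
    assert (Hb1 : b <= 1) by (apply Hlub; intros s [Hs _]; lra).
    assert (Hbelow : forall s, 0 <= s < b -> h s <= r).
    { intros s Hs. apply NNPP. intros Hn. assert (b <= s); [|lra].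
      apply Hlub. intros u [Hu Hu']. apply Rnot_lt_le. intros Hlt.
      apply Hn, Hu'. lra. }
    assert (Hle : h b <= r).
    { apply Rnot_lt_le. intros Hgt.
      assert (Hb : 0 < b).
      { destruct Hb0 as [Hb|Hb]; [exact Hb|]. rewrite <- Hb in Hgt. lra. }
      destruct (Hc b (h b - r) ltac:(lra)) as (d & Hd & H).
      set (u := Rmax 0 (b - d / 2)).
      assert (Hu : 0 <= u < b /\ b - d / 2 <= u).
      { unfold u. pose proof (Rmax_l 0 (b - d / 2)).
        pose proof (Rmax_r 0 (b - d / 2)).
        assert (Rmax 0 (b - d / 2) < b) by (apply Rmax_lub_lt; lra). lra. }
      assert (D : Rabs (h u - h b) < h b - r).
      { apply H. split; [split; [exact I | lra]|].
        change (Rabs (u - b) < d). apply Rabs_def1; lra. }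
      apply Rabs_def2 in D. specialize (Hbelow u ltac:(lra)). lra. }
    assert (Hge : r <= h b).
    { apply Rnot_lt_le. intros Hlt.
      destruct (Hc b (r - h b) ltac:(lra)) as (d & Hd & H).
      assert (Hb : b < 1).
      { destruct Hb1 as [Hb| ->]; [exact Hb|]. lra. }
      assert (Hnear : forall u, b <= u -> u < b + d -> h u <= r).
      { intros u Hu1 Hu2. destruct (Req_dec u b) as [->|N]; [lra|].
        assert (D : Rabs (h u - h b) < r - h b).
        { apply H. split; [split; [exact I | auto]|].
          change (Rabs (u - b) < d). apply Rabs_def1; lra. }
        apply Rabs_def2 in D. lra. }
      set (u := Rmin 1 (b + d / 2)).
      assert (Hu : b < u <= 1 /\ u <= b + d / 2).
      { unfold u. pose proof (Rmin_l 1 (b + d / 2)).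
        pose proof (Rmin_r 1 (b + d / 2)).
        assert (b < Rmin 1 (b + d / 2)) by (apply Rmin_glb_lt; lra). lra. }
      assert (u <= b); [|lra]. apply Hub. split; [lra|].
      intros x Hx. destruct (Rlt_dec x b); [apply Hbelow; lra|].
      apply Hnear; lra. }
    exists b. split; [lra|]. split; [lra|].
    intros s Hs. destruct (Req_dec s b) as [->|N]; [exact Hle|].
    apply Hbelow. lra.
Qed.

Lemma clamp_continuity (b : R) : continuity (fun s => Rmax 0 (Rmin b s)).
Proof.
  intros s. apply continuity_pt_filterlim.
  apply (continuous_comp (fun s => Rmin b s) (fun s => Rmax 0 s)).
  - intros P [e He]. exists e. intros y Hy. apply He.
    change (Rabs (Rmin b y - Rmin b s) < e). change (Rabs (y - s) < e) in Hy.
    apply Rabs_def2 in Hy. apply Rabs_def1; unfold Rmin;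
      destruct (Rle_dec b y), (Rle_dec b s); lra.
  - intros P [e He]. exists e. intros y Hy. apply He.
    change (Rabs (Rmax 0 y - Rmax 0 (Rmin b s)) < e).
    change (Rabs (y - Rmin b s) < e) in Hy.
    set (x := Rmin b s) in *.
    apply Rabs_def2 in Hy. apply Rabs_def1; unfold Rmax;
      destruct (Rle_dec 0 y), (Rle_dec 0 x); lra.
Qed.

Lemma unit_circle_angle (x y : R) :
  x ^ 2 + y ^ 2 = 1 -> exists th, cos th = x /\ sin th = y.
Proof.
  intros H. pose proof (pow2_ge_0 x). pose proof (pow2_ge_0 y).
  assert (Hx : -1 <= x <= 1) by nra.
  assert (Hs : sin (acos x) = Rabs y).
  { rewrite sin_acos by exact Hx.
    replace (1 - Rsqr x) with (Rsqr y) by (unfold Rsqr; lra).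
    apply sqrt_Rsqr_abs. }
  destruct (Rle_dec 0 y) as [Hy|Hy].
  - exists (acos x). split; [apply cos_acos, Hx|].
    rewrite Hs. apply Rabs_pos_eq, Hy.
  - exists (- acos x). split.
    + rewrite cos_neg. apply cos_acos, Hx.
    + rewrite sin_neg, Hs, Rabs_left by lra. ring.
Qed.

Lemma polar_form (w : C) : exists th, w = circle_point (Cmod w) th.
Proof.
  destruct (Ceq_dec w 0) as [->|N].
  - exists 0. rewrite Cmod_0, circle_point_0. reflexivity.
  - apply Cmod_gt_0 in N.
    destruct (unit_circle_angle (Re w / Cmod w) (Im w / Cmod w)) as (th & Hc & Hs).
    + replace ((Re w / Cmod w) ^ 2 + (Im w / Cmod w) ^ 2)
        with ((Re w ^ 2 + Im w ^ 2) / Cmod w ^ 2) by (field; lra).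
      rewrite <- Cmod2_alt. field. lra.
    + exists th. unfold circle_point. rewrite Hc, Hs.
      replace (Cmod w * (Re w / Cmod w)) with (Re w) by (field; lra).
      replace (Cmod w * (Im w / Cmod w)) with (Im w) by (field; lra).
      destruct w; reflexivity.
Qed.

Definition relative_angle (alpha : R) (w : C) : R :=
  atan (Im (w * Cconj (circle_point 1 alpha)) / Re (w * Cconj (circle_point 1 alpha))).

(** In the half-plane around the direction [alpha], the arctangent of the slope is
    a continuous choice of the angle. *)
Lemma relative_angle_polar (alpha : R) (w : C) :
  0 < Re (w * Cconj (circle_point 1 alpha)) ->
  w = circle_point (Cmod w) (alpha + relative_angle alpha w).
Proof.
  intros Hx. unfold relative_angle.
  set (x := Re (w * Cconj (circle_point 1 alpha))) in *.
  set (y := Im (w * Cconj (circle_point 1 alpha))).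
  assert (Em : Cmod w = Cmod (w * Cconj (circle_point 1 alpha))).
  { rewrite Cmod_mult, Cmod_conj, Cmod_circle_point by lra. ring. }
  assert (Es : sqrt (1 + Rsqr (y / x)) = Cmod w / x).
  { replace (1 + Rsqr (y / x)) with (Rsqr (Cmod w / x)).
    - apply sqrt_Rsqr. apply Rdiv_le_0_compat; [apply Cmod_ge_0 | exact Hx].
    - unfold Rsqr.
      replace (Cmod w / x * (Cmod w / x)) with (Cmod w ^ 2 / x ^ 2) by (field; lra).
      rewrite Em, Cmod2_alt. fold x y. field. lra. }
  assert (Hw : 0 < Cmod w).
  { rewrite Em. eapply Rlt_le_trans; [exact Hx|]. apply Re_bounds. }
  assert (Ec : Cmod w * cos (atan (y / x)) = x).
  { rewrite cos_atan, Es. field. lra. }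
  assert (Ey : Cmod w * sin (atan (y / x)) = y).
  { rewrite sin_atan, Es. field. lra. }
  set (b := atan (y / x)) in *.
  unfold circle_point. rewrite cos_plus, sin_plus.
  replace (Cmod w * (cos alpha * cos b - sin alpha * sin b))
    with (cos alpha * (Cmod w * cos b) - sin alpha * (Cmod w * sin b)) by ring.
  replace (Cmod w * (sin alpha * cos b + cos alpha * sin b))
    with (sin alpha * (Cmod w * cos b) + cos alpha * (Cmod w * sin b)) by ring.
  rewrite Ec, Ey. unfold x, y, Re, Im, circle_point; simpl.
  pose proof (sin2_cos2 alpha) as E1. unfold Rsqr in E1.
  destruct w as [a b']; simpl. f_equal.
  - transitivity (a * (sin alpha * sin alpha + cos alpha * cos alpha));
      [rewrite E1; ring | ring].
  - transitivity (b' * (sin alpha * sin alpha + cos alpha * cos alpha));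
      [rewrite E1; ring | ring].
Qed.

Lemma Rabs_sin_le (x : R) : Rabs (sin x) <= Rabs x.
Proof.
  assert (H : forall y, 0 <= y -> Rabs (sin y) <= y).
  { intros y Hy. destruct (MVT_gen sin 0 y cos) as (c & _ & E).
    - intros z _. apply is_derive_sin.
    - intros z _. apply continuity_sin.
    - rewrite sin_0, !Rminus_0_r in E. rewrite E, Rabs_mult, (Rabs_pos_eq y Hy).
      pose proof (COS_bound c).
      assert (Rabs (cos c) <= 1) by (apply Rabs_le; lra).
      pose proof (Rabs_pos (cos c)). nra. }
  destruct (Rle_dec 0 x) as [Hx|Hx].
  - rewrite (Rabs_pos_eq x Hx). apply H, Hx.
  - rewrite <- (Rabs_Ropp x), <- Rabs_Ropp, <- sin_neg.
    rewrite (Rabs_pos_eq (- x)) by lra. apply H. lra.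
Qed.

Lemma circle_point_distance (r1 r2 alpha beta : R) :
  0 <= r1 -> 0 <= r2 <= 1 ->
  Cmod (circle_point r1 (alpha + beta) - circle_point r2 alpha)
    <= Rabs (r1 - r2) + Rabs beta.
Proof.
  intros H1 H2.
  eapply Rle_trans; [apply (Cmod_minus_triangle _ (circle_point r2 (alpha + beta)))|].
  apply Rplus_le_compat.
  - replace (circle_point r1 (alpha + beta) - circle_point r2 (alpha + beta))%C
      with (RtoC (r1 - r2) * circle_point 1 (alpha + beta))%C.
    + rewrite Cmod_mult, Cmod_R, Cmod_circle_point by lra. lra.
    + unfold circle_point. apply injective_projections; simpl; ring.
  - assert (E : Cmod (circle_point r2 (alpha + beta) - circle_point r2 alpha) ^ 2
                = (r2 * (2 * sin (beta / 2))) ^ 2).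
    { rewrite Cmod2_alt. unfold circle_point, Re, Im; simpl.
      replace (cos (alpha + beta)) with (cos (alpha + 2 * (beta / 2)))
        by (f_equal; field).
      replace (sin (alpha + beta)) with (sin (alpha + 2 * (beta / 2)))
        by (f_equal; field).
      rewrite cos_plus, sin_plus, cos_2a_sin, sin_2a.
      pose proof (sin2_cos2 alpha) as E1. pose proof (sin2_cos2 (beta / 2)) as E2.
      unfold Rsqr in E1, E2.
      set (c := cos alpha) in *. set (s := sin alpha) in *.
      set (c' := cos (beta / 2)) in *. set (s' := sin (beta / 2)) in *.
      transitivity (r2 * r2 * (4 * (s' * s')) * (s * s + c * c) * (s' * s' + c' * c')).
      - ring.
      - rewrite E1, E2. ring. }
    assert (Hs : Rabs (r2 * (2 * sin (beta / 2))) <= Rabs beta).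
    { rewrite !Rabs_mult, (Rabs_pos_eq r2), (Rabs_pos_eq 2) by lra.
      pose proof (Rabs_sin_le (beta / 2)) as B.
      replace (Rabs (beta / 2)) with (Rabs beta / 2) in B
        by (unfold Rdiv; rewrite Rabs_mult, (Rabs_pos_eq (/ 2)) by lra; reflexivity).
      pose proof (Rabs_pos (sin (beta / 2))). nra. }
    rewrite <- (Rabs_pos_eq (Cmod _)) by apply Cmod_ge_0.
    eapply Rle_trans; [|exact Hs].
    apply Rsqr_le_abs_0. rewrite !Rsqr_pow2, E. lra.
Qed.

(** Otherwise the path runs near the circle, with a large defect, up to its first
    exit from the disk of radius [r] around [g 0]. There its angle is continuous
    and its modulus varies by at most [eta], hence the angle has to vary by
    [r / 2]. By the intermediate value theorem the path meets all directions in
    between, against [defect_arc_bound]. *)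
Lemma path_small_defect (f : C -> C) (g : R -> C) (delta eta c r : R) :
  disk_map f -> 0 < delta -> eta <= 1 / 4 -> 0 < c -> 0 < r <= 1 / 2 ->
  eta <= r / 2 -> 4 * eta + 3 * delta <= c / 2 -> 960 * PI * delta < c * (r / 2) ->
  Cmod (f 0%C) <= delta -> Cmod (f (RtoC (1 / 2)) - RtoC (1 / 2)) <= delta ->
  path_continuous g -> (forall s, 0 <= s <= 1 -> Cmod (g s) < 1) ->
  r <= Cmod (g 1 - g 0) ->
  exists s, 0 <= s <= 1 /\ Cmod (g s - g 0) <= r /\
    (Cmod (g s) <= 1 - eta \/ defect f (g s) < c).
Proof.
  intros Hf Hdelta Heta Hc Hr Hetar Hsmall Hsmall2 H0 H1 Hg Hdisk Hexit.
  destruct (first_exit (fun s => Cmod (g s - g 0)) r) as (b & Hb & Eb & Hbelow).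
  - apply (path_continuity_pt g (fun z => Cmod (z - g 0)%C)); [|exact Hg].
    intros z w. eapply Rle_trans; [apply Cmod_triangle_inv|].
    right. f_equal. ring.
  - replace (g 0 - g 0)%C with (0 : C) by ring. rewrite Cmod_0. lra.
  - exact Hexit.
  - apply NNPP. intros Hno.
    assert (Hslow : forall s, 0 <= s <= b ->
      1 - eta < Cmod (g s) /\ c <= defect f (g s)).
    { intros s Hs. split; [apply Rnot_le_lt | apply Rnot_lt_le]; intros Hn; apply Hno;
        exists s; (split; [lra|]; split; [apply Hbelow, Hs|]); auto. }
    (* Freezing the path outside [[0, b]] makes its angle continuous on the line. *)
    set (k := fun s => Rmax 0 (Rmin b s)).
    assert (Hk : forall s, 0 <= k s <= b).
    { intros s. unfold k. split; [apply Rmax_l|].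
      apply Rmax_lub; [lra | apply Rmin_l]. }
    assert (Hkid : forall s, 0 <= s <= b -> k s = s).
    { intros s Hs. unfold k. rewrite Rmin_right, Rmax_right by lra. reflexivity. }
    set (p := fun s => g (k s)).
    assert (Hp : path_continuous p)
      by (apply (path_comp g k); [exact Hg | apply clamp_continuity]).
    (* By compactness the path stays in a smaller disk, as required for the
       choice of a circle that surrounds it. *)
    destruct (continuity_ab_maj (fun s => Cmod (p s)) 0 b ltac:(lra)) as (sm & Hsm & _).
    { intros s _. apply (path_continuity_pt p Cmod); [apply Cmod_triangle_inv | exact Hp]. }
    set (rhomax := Cmod (p sm)) in *.
    assert (Hrm : rhomax < 1) by (apply Hdisk; specialize (Hk sm); lra).
    destruct (polar_form (g 0)) as [alpha Ealpha].
    assert (Hx : forall s, 0 < Re (p s * Cconj (circle_point 1 alpha))%C).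
    { intros s. specialize (Hbelow (k s) (Hk s)). fold (p s) in Hbelow.
      pose proof (Hslow 0 ltac:(lra)) as [Hs0 _].
      assert (E : (p s * Cconj (circle_point 1 alpha)
        = (p s - g 0) * Cconj (circle_point 1 alpha)
          + g 0 * Cconj (circle_point 1 alpha))%C) by ring.
      assert (E0 : Re (g 0 * Cconj (circle_point 1 alpha))%C = Cmod (g 0)).
      { rewrite Ealpha at 1. unfold circle_point, Re; simpl.
        pose proof (sin2_cos2 alpha) as E1. unfold Rsqr in E1.
        transitivity (Cmod (g 0) * (sin alpha * sin alpha + cos alpha * cos alpha));
          [ring | rewrite E1; ring]. }
      pose proof (Re_bounds ((p s - g 0) * Cconj (circle_point 1 alpha))%C) as B.
      rewrite Cmod_mult, Cmod_conj, Cmod_circle_point in B by lra.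
      rewrite E. change (0 < Re ((p s - g 0) * Cconj (circle_point 1 alpha))%C
        + Re (g 0 * Cconj (circle_point 1 alpha))%C).
      rewrite E0. lra. }
    set (beta := fun s => relative_angle alpha (p s)).
    assert (Hlip : forall z w, Rabs (Re (z * Cconj (circle_point 1 alpha))%C
              - Re (w * Cconj (circle_point 1 alpha))%C) <= Cmod (z - w)).
    { intros z w.
      replace (Cmod (z - w)) with (Cmod ((z - w) * Cconj (circle_point 1 alpha)))
        by (rewrite Cmod_mult, Cmod_conj, Cmod_circle_point by lra; ring).
      eapply Rle_trans; [|apply re_le_Cmod]. right. f_equal.
      unfold Re; simpl. ring. }
    assert (Hlip' : forall z w, Rabs (Im (z * Cconj (circle_point 1 alpha))%C
              - Im (w * Cconj (circle_point 1 alpha))%C) <= Cmod (z - w)).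
    { intros z w.
      replace (Cmod (z - w)) with (Cmod ((z - w) * Cconj (circle_point 1 alpha)))
        by (rewrite Cmod_mult, Cmod_conj, Cmod_circle_point by lra; ring).
      eapply Rle_trans; [|apply im_le_Cmod]. right. f_equal.
      unfold Im; simpl. ring. }
    assert (Hbeta : continuity beta).
    { intros s.
      apply (continuity_pt_comp
        (fun s => Im (p s * Cconj (circle_point 1 alpha))%C
                  / Re (p s * Cconj (circle_point 1 alpha))%C)
        atan).
      - apply (continuity_pt_div
          (fun s => Im (p s * Cconj (circle_point 1 alpha))%C)
          (fun s => Re (p s * Cconj (circle_point 1 alpha))%C)).
        + apply (path_continuity_pt p
            (fun z => Im (z * Cconj (circle_point 1 alpha))%C) Hlip' Hp).
        + apply (path_continuity_pt p
            (fun z => Re (z * Cconj (circle_point 1 alpha))%C) Hlip Hp).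
        + specialize (Hx s). lra.
      - apply derivable_continuous_pt, derivable_pt_atan. }
    assert (Hpolar : forall s, p s = circle_point (Cmod (p s)) (alpha + beta s)).
    { intros s. apply relative_angle_polar, Hx. }
    assert (Ep0 : p 0 = g 0) by (unfold p; rewrite Hkid by lra; reflexivity).
    assert (Epb : p b = g b) by (unfold p; rewrite Hkid by lra; reflexivity).
    assert (Hbeta0 : beta 0 = 0).
    { unfold beta, relative_angle. rewrite Ep0, Ealpha.
      replace (Im (circle_point (Cmod (g 0)) alpha * Cconj (circle_point 1 alpha))%C) with 0.
      - unfold Rdiv. rewrite Rmult_0_l. apply atan_0.
      - unfold circle_point, Im; simpl. ring. }
    assert (Hbetab : r / 2 <= Rabs (beta b)).
    { pose proof (Hslow 0 ltac:(lra)) as [Hs0 _].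
      pose proof (Hslow b ltac:(lra)) as [Hsb _].
      pose proof (Hdisk 0 ltac:(lra)). pose proof (Hdisk b ltac:(lra)).
      pose proof (circle_point_distance (Cmod (g b)) (Cmod (g 0)) alpha (beta b)
        (Cmod_ge_0 _) ltac:(lra)) as D.
      rewrite <- Ealpha in D. rewrite <- Epb in D at 1. rewrite <- Hpolar, Epb in D.
      simpl in Eb. rewrite Eb in D.
      assert (Rabs (Cmod (g b) - Cmod (g 0)) <= eta) by (apply Rabs_le; lra).
      lra. }
    assert (HbPI : Rabs (beta b) < PI / 2).
    { pose proof (atan_bound (Im (p b * Cconj (circle_point 1 alpha))%C
        / Re (p b * Cconj (circle_point 1 alpha))%C)) as B.
      unfold beta, relative_angle. apply Rabs_def1; lra. }
    pose proof PI_RGT_0.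
    assert (Hrange : Rmax 0 (beta b) - Rmin 0 (beta b) = Rabs (beta b)).
    { unfold Rmax, Rmin, Rabs. destruct (Rle_dec 0 (beta b)), (Rcase_abs (beta b)); lra. }
    pose proof (defect_arc_bound f delta eta c rhomax
      (alpha + Rmin 0 (beta b)) (alpha + Rmax 0 (beta b)) Hf Hdelta Heta Hrm Hc
      Hsmall H0 H1) as A.
    assert (Hfin : c * (alpha + Rmax 0 (beta b) - (alpha + Rmin 0 (beta b)))
                   <= 960 * PI * delta).
    { apply A.
      - pose proof (Rabs_pos (beta b)). lra.
      - intros th Hth.
        destruct (IVT_gen beta 0 b (th - alpha) Hbeta) as (s & Hs & Es).
        { rewrite Hbeta0. lra. }
        rewrite Rmin_left, Rmax_right in Hs by lra.
        exists (Cmod (p s)).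
        replace th with (alpha + beta s) by lra.
        rewrite <- Hpolar.
        destruct (Hslow (k s) (Hk s)) as [S1 S2]. fold (p s) in S1, S2.
        specialize (Hsm s ltac:(lra)). fold rhomax in Hsm. simpl in Hsm.
        repeat split; try lra. }
    replace (alpha + Rmax 0 (beta b) - (alpha + Rmin 0 (beta b)))
      with (Rabs (beta b)) in Hfin by lra.
    assert (c * (r / 2) <= c * Rabs (beta b)) by (apply Rmult_le_compat_l; lra).
    lra.
Qed.

(** * Trajectories of the semigroup *)

(** Shifting the sampling times of the second window by the integer part [j] of
    [(s2 - s1) / h] matches them with those of the first window up to less than
    one step. At the common times, at least [3 * N] of them, the two distances
    add up to at least the distance of [w s1] and [w s2], up to [kappa]. *)
Lemma slow_times_close (w : R -> C) (N : nat) (t s1 s2 c kappa : R) :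
  (0 < N)%nat -> 0 < t -> 0 <= s1 -> s1 <= s2 <= s1 + t ->
  (forall u u', 0 <= u -> 0 <= u' -> Rabs (u - u') <= t / INR N ->
    Cmod (w u - w u') <= kappa) ->
  rsum (fun k => Cmod (w (s1 + INR k * (t / INR N)) - w s1) ^ 2) (4 * N)
    <= INR (4 * N) * c ->
  rsum (fun k => Cmod (w (s2 + INR k * (t / INR N)) - w s2) ^ 2) (4 * N)
    <= INR (4 * N) * c ->
  kappa <= Cmod (w s1 - w s2) ->
  (Cmod (w s1 - w s2) - kappa) ^ 2 <= 6 * c.
Proof.
  intros HN Ht Hs1 Hs12 Hw S1 S2 HD.
  assert (HN' : 0 < INR N) by (apply lt_0_INR; exact HN).
  set (h := t / INR N) in *.
  assert (Hh : 0 < h) by (apply Rdiv_lt_0_compat; assumption).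
  set (D := Cmod (w s1 - w s2) - kappa).
  destruct (nfloor_ex ((s2 - s1) / h)) as [j Hj].
  { apply Rdiv_le_0_compat; lra. }
  assert (Hj' : INR j * h <= s2 - s1 < (INR j + 1) * h).
  { split.
    - apply (Rmult_le_reg_r (/ h)); [apply Rinv_0_lt_compat, Hh|].
      rewrite Rmult_assoc, Rinv_r by lra. unfold Rdiv in Hj. lra.
    - apply (Rmult_lt_reg_r (/ h)); [apply Rinv_0_lt_compat, Hh|].
      rewrite Rmult_assoc, Rinv_r by lra. unfold Rdiv in Hj. lra. }
  assert (HjN : (j <= N)%nat).
  { apply INR_le. apply (Rmult_le_reg_r h); [exact Hh|].
    replace (INR N * h) with t by (unfold h; field; lra). lra. }
  set (x := fun k => Cmod (w (s1 + INR k * h) - w s1)).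
  set (y := fun k => Cmod (w (s2 + INR k * h) - w s2)).
  assert (Hxy : forall k, D ^ 2 / 2 <= x (k + j)%nat ^ 2 + y k ^ 2).
  { intros k.
    assert (Hk : 0 <= INR k * h)
      by (apply Rmult_le_pos; [apply pos_INR | lra]).
    assert (Hjk : 0 <= INR j * h)
      by (apply Rmult_le_pos; [apply pos_INR | lra]).
    assert (Hc : Cmod (w (s1 + INR (k + j) * h) - w (s2 + INR k * h)) <= kappa).
    { apply Hw; rewrite ?plus_INR; try lra. apply Rabs_le; lra. }
    assert (T : D <= x (k + j)%nat + y k).
    { unfold D, x, y.
      pose proof (Cmod_minus_triangle (w s1) (w (s1 + INR (k + j) * h)) (w s2)) as T1.
      pose proof (Cmod_minus_triangle (w (s1 + INR (k + j) * h))
        (w (s2 + INR k * h)) (w s2)) as T2.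
      rewrite (Cmod_minus_sym (w s1) (w (s1 + INR (k + j) * h))) in T1. lra. }
    assert (0 <= D) by (unfold D; lra).
    pose proof (pow2_ge_0 (x (k + j)%nat - y k)).
    assert (D ^ 2 <= (x (k + j)%nat + y k) ^ 2) by (apply pow_incr; lra).
    lra. }
  assert (L : INR (3 * N) * (D ^ 2 / 2)
    <= rsum (fun k => x (k + j)%nat ^ 2 + y k ^ 2) (3 * N)).
  { rewrite <- rsum_const. apply rsum_le. intros k _. apply Hxy. }
  rewrite rsum_plus in L.
  pose proof (rsum_shift_le (fun k => x k ^ 2) j (3 * N) (4 * N)
    (fun k => pow2_ge_0 _) ltac:(lia)) as L1.
  pose proof (rsum_nonneg_le (fun k => y k ^ 2) (3 * N) (4 * N)
    (fun k => pow2_ge_0 _) ltac:(lia)) as L2.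
  unfold x, y in L, L1, L2. cbv beta in L, L1, L2.
  rewrite mult_INR in L, S1, S2.
  replace (INR 3) with 3 in L by (simpl; ring).
  replace (INR 4) with 4 in S1, S2 by (simpl; ring).
  assert (INR N * (3 * (D ^ 2 / 2)) <= INR N * (8 * c)) by lra.
  assert (3 * (D ^ 2 / 2) <= 8 * c) by (apply (Rmult_le_reg_l (INR N)); lra).
  assert (0 <= c).
  { pose proof (pow2_ge_0 D). lra. }
  lra.
Qed.

Section Semigroup.

Variable phi : R -> C -> C.
Hypothesis Hphi : one_parameter_semigroup phi.

Lemma semigroup_disk_map (t : R) : 0 <= t -> disk_map (phi t).
Proof.
  intros Ht. split.
  - intros z Hz. apply ex_derive_C_differentiable.
    apply (semigroup_holomorphic phi Hphi t Ht z Hz).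
  - intros z Hz. apply (semigroup_disk phi Hphi t z Ht Hz).
Qed.

Lemma semigroup_continuous_0 (z : C) :
  Cmod z < 1 -> forall eps, 0 < eps -> exists T, 0 < T /\
  forall t, 0 <= t < T -> Cmod (phi t z - z) < eps.
Proof.
  intros Hz eps He.
  assert (He' : 0 < eps / 2) by lra.
  pose proof (semigroup_lim_0 phi Hphi z Hz) as L.
  destruct (L (fun w => Cmod (w - z) < eps)) as [d Hd].
  - exists (mkposreal _ He'). intros w [H1 H2].
    change (Rabs (fst w - fst z) < eps / 2) in H1.
    change (Rabs (snd w - snd z) < eps / 2) in H2.
    eapply Rle_lt_trans; [apply Cmod_le_Re_Im|].
    change (Rabs (fst w - fst z) + Rabs (snd w - snd z) < eps). lra.
  - exists d. split; [apply cond_pos|]. intros t Ht.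
    destruct (Req_dec t 0) as [->|N].
    + rewrite (semigroup_0 phi Hphi z Hz).
      replace (z - z)%C with (0 : C) by ring. rewrite Cmod_0. exact He.
    + apply Hd; [|lra]. change (Rabs (t - 0) < d). apply Rabs_def1; lra.
Qed.

(** The maps [phi s] are Lipschitz near [z] with a constant independent of [s], and
    [phi (s + h) z] and [phi s z] are the images under [phi s] of the nearby
    points [phi h z] and [z]. *)
Lemma trajectory_uniformly_continuous (z : C) :
  Cmod z < 1 -> forall eps, 0 < eps -> exists d, 0 < d /\
  forall s t, 0 <= s -> 0 <= t -> Rabs (s - t) < d ->
    Cmod (phi s z - phi t z) < eps.
Proof.
  intros Hz eps He. pose proof (Cmod_ge_0 z).
  set (rho := (1 + Cmod z) / 2).
  destruct (disk_map_equilipschitz rho ltac:(unfold rho; lra)) as (L & HL & Hlip).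
  assert (He1 : 0 < Rmin (eps / L) ((1 - Cmod z) / 2)).
  { apply Rmin_pos; [apply Rdiv_lt_0_compat; lra | lra]. }
  destruct (semigroup_continuous_0 z Hz _ He1) as (d & Hd & H0).
  exists d. split; [exact Hd|].
  assert (Hle : forall s t, 0 <= s -> s <= t -> t - s < d ->
    Cmod (phi t z - phi s z) < eps).
  { intros s t Hs Hst Hd'.
    specialize (H0 (t - s) ltac:(lra)).
    pose proof (Rmin_l (eps / L) ((1 - Cmod z) / 2)).
    pose proof (Rmin_r (eps / L) ((1 - Cmod z) / 2)).
    replace t with (s + (t - s)) at 1 by ring.
    rewrite (semigroup_add phi Hphi s (t - s) z) by (auto; lra).
    eapply Rle_lt_trans.
    - apply Hlip; [apply semigroup_disk_map, Hs| |unfold rho; lra].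
      pose proof (Cmod_triangle (phi (t - s) z - z) z) as T.
      replace (phi (t - s) z - z + z)%C with (phi (t - s) z) in T by ring.
      unfold rho. lra.
    - apply Rlt_le_trans with (L * (eps / L)); [apply Rmult_lt_compat_l; lra|].
      right. field. lra. }
  intros s t Hs Ht Hst. apply Rabs_def2 in Hst.
  destruct (Rle_dec s t).
  - rewrite Cmod_minus_sym. apply Hle; lra.
  - apply Hle; lra.
Qed.

(** [path_small_defect] for the average of the maps [phi (k h)]. If the point that
    it provides is not near the circle, then the trajectory moves slowly there by
    [displacement_inside]. *)
Lemma slow_time (g : R -> C) (n : nat) (h delta eta c r d : R) :
  (0 < n)%nat -> 0 < h -> 0 < delta -> 0 < eta <= 1 / 4 -> 0 < c ->
  0 < r <= 1 / 2 -> eta <= r / 2 -> 4 * eta + 3 * delta <= c / 2 ->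
  960 * PI * delta < c * (r / 2) ->
  (forall k, (k < n)%nat -> Cmod (phi (INR k * h) 0 - 0) <= delta) ->
  (forall k, (k < n)%nat ->
    Cmod (phi (INR k * h) (RtoC (1 / 2)) - RtoC (1 / 2)) <= delta) ->
  0 < d -> 4 / eta * (d / 2 + 30 * delta / d) <= sqrt (2 * c) ->
  path_continuous g -> (forall s, 0 <= s <= 1 -> Cmod (g s) < 1) ->
  r <= Cmod (g 1 - g 0) ->
  exists s, 0 <= s <= 1 /\ Cmod (g s - g 0) <= r /\
    rsum (fun k => Cmod (phi (INR k * h) (g s) - g s) ^ 2) n <= INR n * (2 * c).
Proof.
  intros Hn Hh Hdelta Heta Hc Hr Hetar Hs1 Hs2 H0 H1 Hd Hs3 Hg Hdisk Hexit.
  set (fs := fun k => phi (INR k * h)).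
  assert (Hfs : forall k, (k < n)%nat -> disk_map (fs k)).
  { intros k _. apply semigroup_disk_map.
    apply Rmult_le_pos; [apply pos_INR | lra]. }
  assert (E0 : forall w : C, (w - 0)%C = w) by (intros w; ring).
  destruct (path_small_defect (average fs n) g delta eta c r)
    as (s & Hs & Hsr & Hcase); auto; try lra.
  - apply average_disk_map; assumption.
  - rewrite <- (E0 (average fs n 0%C)). apply average_displacement; assumption.
  - apply average_displacement; assumption.
  - exists s. split; [exact Hs|]. split; [exact Hsr|].
    destruct Hcase as [Hin|Hdef].
    + rewrite <- rsum_const. apply rsum_le. intros k Hk.
      assert (D : Cmod (fs k (g s) - g s) <= sqrt (2 * c)).
      { eapply Rle_trans; [|exact Hs3].
        apply displacement_inside; auto; try lra.
        - rewrite <- (E0 (fs k 0%C)). apply H0, Hk.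
        - apply H1, Hk. }
      rewrite <- (pow2_sqrt (2 * c)) by lra.
      apply pow_incr. split; [apply Cmod_ge_0 | exact D].
    + pose proof (average_displacement_sqr fs n Hn Hfs (g s) (Hdisk s Hs)) as A.
      unfold fs in A at 1. eapply Rle_trans; [exact A|].
      assert (INR n * defect (average fs n) (g s) <= INR n * c)
        by (apply Rmult_le_compat_l; [apply pos_INR | lra]).
      lra.
Qed.

Lemma path_affine (w : R -> C) (a b : R) :
  path_continuous w -> path_continuous (fun s => w (a + b * s)).
Proof.
  intros Hw. apply (path_comp w (fun s => a + b * s)); [exact Hw|].
  intros s. reg.
Qed.

(** A trajectory that moves by [eps] within a short time [t] would have two slow
    points, one near its start and one near its end, the latter found on the
    reversed path. Each of the constants [r], [c], [eta], [delta] is small compared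
    with the preceding one. *)
Lemma uniform_displacement (eps : R) :
  0 < eps <= 1 -> exists T, 0 < T /\
  forall t z, 0 <= t < T -> Cmod z < 1 -> Cmod (phi t z - z) < eps.
Proof.
  intros Heps.
  set (c := eps ^ 2 / 64). set (r := eps / 8). set (eta := c / 32).
  set (delta := eta ^ 2 * eps ^ 2 / 100000).
  set (d := eta * eps / 24).
  assert (He2 : 0 < eps ^ 2 <= eps) by nra.
  assert (Hc : 0 < c <= 1 / 64) by (unfold c; lra).
  assert (Heta : 0 < eta <= 1 / 2048) by (unfold eta; lra).
  assert (Heta2 : 0 < eta ^ 2 <= eta) by nra.
  assert (Hdelta : 0 < delta).
  { unfold delta. apply Rdiv_lt_0_compat; [|lra]. apply Rmult_lt_0_compat; lra. }
  assert (Hdelta2 : delta <= eta * eps / 100000).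
  { unfold delta. apply Rmult_le_compat_r; [lra|].
    apply Rmult_le_compat; lra. }
  assert (Hee : 0 < eta * eps <= eta) by nra.
  assert (Hd : 0 < d) by (unfold d; lra).
  assert (C1 : 4 * eta + 3 * delta <= c / 2) by (unfold eta in *; lra).
  assert (C2 : 960 * PI * delta < c * (r / 2)).
  { pose proof PI_4. pose proof PI_RGT_0.
    assert (960 * PI * delta <= 960 * 4 * (eta * eps / 100000)).
    { apply Rmult_le_compat; lra. }
    replace (c * (r / 2)) with (eta * eps * 2) by (unfold eta, r; field).
    lra. }
  assert (C3 : 4 / eta * (d / 2 + 30 * delta / d) <= sqrt (2 * c)).
  { replace (4 / eta * (d / 2 + 30 * delta / d))
      with (eps / 12 + eps * (2880 / 100000)) by (unfold delta, d; field; lra).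
    apply Rle_trans with (sqrt ((eps / 6) ^ 2)).
    - rewrite sqrt_pow2 by lra. lra.
    - apply sqrt_le_1_alt. unfold c.
      replace ((eps / 6) ^ 2) with (eps ^ 2 / 36) by field. lra. }
  destruct (semigroup_continuous_0 0%C ltac:(rewrite Cmod_0; lra) delta Hdelta)
    as (T0 & HT0 & H0).
  destruct (semigroup_continuous_0 (RtoC (1 / 2))
    ltac:(rewrite Cmod_R, Rabs_pos_eq; lra) delta Hdelta) as (T1 & HT1 & H1).
  exists (Rmin T0 T1 / 4).
  assert (HT : 0 < Rmin T0 T1) by (apply Rmin_pos; assumption).
  pose proof (Rmin_l T0 T1). pose proof (Rmin_r T0 T1).
  split; [lra|]. intros t z Ht Hz.
  apply Rnot_le_lt. intros Hbig.
  assert (Ht0 : 0 < t).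
  { destruct (proj1 Ht) as [Hp|E]; [exact Hp|]. rewrite <- E in Hbig.
    rewrite (semigroup_0 phi Hphi z Hz) in Hbig.
    replace (z - z)%C with (0 : C) in Hbig by ring.
    rewrite Cmod_0 in Hbig. lra. }
  destruct (trajectory_uniformly_continuous z Hz (eps / 8) ltac:(lra))
    as (du & Hdu & Hunif).
  destruct (nfloor_ex (t / du)) as [N0 HN0].
  { apply Rdiv_le_0_compat; lra. }
  (* A sampling step below the modulus of continuity of this trajectory at scale
     [eps / 8]; the estimates do not depend on the number of samples. *)
  set (N := S N0).
  assert (HN : 0 < INR N) by (apply lt_0_INR; unfold N; lia).
  assert (HNdu : t / INR N < du).
  { apply (Rmult_lt_reg_r (INR N)); [exact HN|].
    unfold Rdiv. rewrite Rmult_assoc, Rinv_l, Rmult_1_r by lra.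
    apply (Rmult_lt_reg_r (/ du)); [apply Rinv_0_lt_compat, Hdu|].
    replace (du * INR N * / du) with (INR N) by (field; lra).
    unfold N. rewrite S_INR. unfold Rdiv in HN0. lra. }
  set (h := t / INR N).
  assert (Hh : 0 < h) by (apply Rdiv_lt_0_compat; lra).
  set (w := fun s => phi (Rmax 0 s) z).
  assert (Ew : forall s, 0 <= s -> w s = phi s z).
  { intros s Hs. unfold w. rewrite Rmax_right by exact Hs. reflexivity. }
  assert (Hw : path_continuous w).
  { intros s e He.
    destruct (trajectory_uniformly_continuous z Hz e He) as (d' & Hd' & H').
    exists d'. split; [exact Hd'|]. intros u Hu.
    apply H'; try apply Rmax_l.
    eapply Rle_lt_trans; [|exact Hu].
    unfold Rmax. destruct (Rle_dec 0 u), (Rle_dec 0 s);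
      unfold Rabs; repeat destruct Rcase_abs; lra. }
  assert (Hwdisk : forall s, Cmod (w s) < 1).
  { intros s. apply (semigroup_disk phi Hphi); [apply Rmax_l | exact Hz]. }
  assert (Hflow : forall s k, 0 <= s ->
    phi (INR k * h) (w s) = w (s + INR k * h)).
  { intros s k Hs.
    assert (0 <= INR k * h) by (apply Rmult_le_pos; [apply pos_INR | lra]).
    rewrite !Ew by lra. rewrite <- (semigroup_add phi Hphi) by (auto; lra).
    f_equal. ring. }
  assert (Htau : forall k, (k < 4 * N)%nat -> 0 <= INR k * h < Rmin T0 T1).
  { intros k Hk. split; [apply Rmult_le_pos; [apply pos_INR | lra]|].
    apply Rlt_trans with (INR (4 * N) * h).
    - apply Rmult_lt_compat_r; [exact Hh | apply lt_INR, Hk].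
    - rewrite mult_INR. replace (INR 4) with 4 by (simpl; ring).
      unfold h. replace (4 * INR N * (t / INR N)) with (4 * t) by (field; lra).
      lra. }
  assert (Hbig' : eps <= Cmod (w t - w 0)).
  { rewrite !Ew by lra. rewrite (semigroup_0 phi Hphi z Hz). exact Hbig. }
  assert (Hslow : forall a b, path_continuous (fun s => w (a + b * s)) ->
    r <= Cmod (w (a + b * 1) - w (a + b * 0)) ->
    exists s, 0 <= s <= 1 /\ Cmod (w (a + b * s) - w (a + b * 0)) <= r /\
      rsum (fun k => Cmod (phi (INR k * h) (w (a + b * s)) - w (a + b * s)) ^ 2)
        (4 * N) <= INR (4 * N) * (2 * c)).
  { intros a b Hcont Hab.
    apply (slow_time (fun s => w (a + b * s)) (4 * N) h delta eta c r d);
      auto; try (unfold r; lra).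
    - unfold N. lia.
    - unfold r, eta, c. lra.
    - intros k Hk. left. apply H0. specialize (Htau k Hk). lra.
    - intros k Hk. left. apply H1. specialize (Htau k Hk). lra. }
  destruct (Hslow 0 t (path_affine w 0 t Hw)) as (u1 & Hu1 & D1 & S1).
  { rewrite Rmult_0_r, Rmult_1_r, Rplus_0_l, Rplus_0_r. unfold r. lra. }
  destruct (Hslow t (- t) (path_affine w t (- t) Hw)) as (u2 & Hu2 & D2 & S2).
  { rewrite Rmult_0_r, Rmult_1_r, Rplus_0_r, Rplus_opp_r, Cmod_minus_sym.
    unfold r. lra. }
  assert (Hs1 : 0 <= 0 + t * u1 <= t) by nra.
  assert (Hs2 : 0 <= t + - t * u2 <= t) by nra.
  rewrite Rmult_0_r, Rplus_0_r in D1, D2.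
  set (s1 := 0 + t * u1) in *. set (s2 := t + - t * u2) in *.
  assert (S1' : rsum (fun k => Cmod (w (s1 + INR k * (t / INR N)) - w s1) ^ 2) (4 * N)
                <= INR (4 * N) * (2 * c)).
  { eapply Rle_trans; [|exact S1]. apply rsum_le. intros k _.
    rewrite Hflow by lra. fold h. lra. }
  assert (S2' : rsum (fun k => Cmod (w (s2 + INR k * (t / INR N)) - w s2) ^ 2) (4 * N)
                <= INR (4 * N) * (2 * c)).
  { eapply Rle_trans; [|exact S2]. apply rsum_le. intros k _.
    rewrite Hflow by lra. fold h. lra. }
  assert (Hkappa : forall u u', 0 <= u -> 0 <= u' -> Rabs (u - u') <= t / INR N ->
    Cmod (w u - w u') <= eps / 8).
  { intros u u' Hu Hu' Huu. rewrite !Ew by assumption. left.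
    apply Hunif; auto. lra. }
  assert (Hfar : 3 * eps / 4 <= Cmod (w s1 - w s2)).
  { pose proof (Cmod_minus_triangle (w t) (w s2) (w 0)) as A1.
    pose proof (Cmod_minus_triangle (w s2) (w s1) (w 0)) as A2.
    rewrite (Cmod_minus_sym (w t) (w s2)) in A1.
    rewrite (Cmod_minus_sym (w s2) (w s1)) in A2.
    unfold r in D1, D2. lra. }
  assert (Hend : (Cmod (w s1 - w s2) - eps / 8) ^ 2 <= 6 * (2 * c)).
  { destruct (Rle_dec s1 s2).
    - apply (slow_times_close w N t s1 s2 (2 * c) (eps / 8)); auto; try lra.
      unfold N; lia.
    - rewrite (Cmod_minus_sym (w s1) (w s2)) in *.
      apply (slow_times_close w N t s2 s1 (2 * c) (eps / 8)); auto; try lra.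
      unfold N; lia. }
  assert ((eps / 2) ^ 2 <= (Cmod (w s1 - w s2) - eps / 8) ^ 2)
    by (apply pow_incr; lra).
  unfold c in Hend. replace ((eps / 2) ^ 2) with (eps ^ 2 / 4) in * by field.
  lra.
Qed.

End Semigroup.

(** Radii approach the circle inside every Stolz region of aperture larger than 1. *)
Lemma angular_lim_approx (f : C -> C) (sigma l : C) :
  unit_circle sigma -> is_angular_lim f sigma l ->
  forall eps, 0 < eps -> exists d, 0 < d /\ forall x, 0 < x < d -> x < 1 ->
    Cmod (f (RtoC (1 - x) * sigma)%C - l) < eps.
Proof.
  intros Hs Hl eps He.
  assert (He' : 0 < eps / 2) by lra.
  (* Any aperture larger than 1 would do. *)
  destruct (Hl 2 ltac:(lra) (fun w => Cmod (w - l) < eps)) as [d Hd].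
  - exists (mkposreal _ He'). intros w [H1 H2].
    change (Rabs (fst w - fst l) < eps / 2) in H1.
    change (Rabs (snd w - snd l) < eps / 2) in H2.
    eapply Rle_lt_trans; [apply Cmod_le_Re_Im|].
    change (Rabs (fst w - fst l) + Rabs (snd w - snd l) < eps). lra.
  - exists d. split; [apply cond_pos|]. intros x Hx Hx1.
    assert (Em : Cmod (RtoC (1 - x) * sigma) = 1 - x).
    { rewrite Cmod_mult, Cmod_R, Hs, Rabs_pos_eq by lra. ring. }
    assert (Ed : Cmod (sigma - RtoC (1 - x) * sigma) = x).
    { replace (sigma - RtoC (1 - x) * sigma)%C with (RtoC x * sigma)%C
        by (rewrite RtoC_minus; ring).
      rewrite Cmod_mult, Cmod_R, Hs, Rabs_pos_eq by lra. ring. }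
    apply Hd.
    + apply C_NormedModule_mixin_compat1.
      change (Cmod (RtoC (1 - x) * sigma - sigma) < d).
      rewrite Cmod_minus_sym, Ed. lra.
    + split; unfold unit_disk; rewrite ?Em, ?Ed; lra.
Qed.

Theorem proposition3p2 (phi : R -> C -> C)
    (Hsemigroup : one_parameter_semigroup phi)
    (Hnontrivial : nontrivial_semigroup phi)
    (Hextended : extended_by_angular_limits phi) :
  uniformly_equicontinuous closed_unit_disk (fun t : R => (0 <= t)%R)
    (fun (z : C) (t : R) => phi t z).
Proof.
  intros eps Heps.
  set (e := Rmin 1 (eps / 3)).
  assert (He : 0 < e <= 1 /\ e <= eps / 3).
  { unfold e. pose proof (Rmin_l 1 (eps / 3)). pose proof (Rmin_r 1 (eps / 3)).
    assert (0 < Rmin 1 (eps / 3)) by (apply Rmin_pos; lra). lra. }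
  destruct (uniform_displacement phi Hsemigroup e (proj1 He)) as (T & HT & Hdisp).
  exists T. split; [exact HT|].
  assert (Hle : forall z s t, Cmod z < 1 -> 0 <= s -> s <= t -> t - s < T ->
    Cmod (phi t z - phi s z) < e).
  { intros z s t Hz Hs Hst Hd. replace t with (t - s + s) by ring.
    rewrite (semigroup_add phi Hsemigroup) by (auto; lra).
    apply Hdisp; [lra|]. apply (semigroup_disk phi Hsemigroup); assumption. }
  assert (Hin : forall z s t, Cmod z < 1 -> 0 <= s -> 0 <= t ->
    Rabs (s - t) < T -> Cmod (phi s z - phi t z) < e).
  { intros z s t Hz Hs Ht Hst. apply Rabs_def2 in Hst.
    destruct (Rle_dec s t).
    - rewrite Cmod_minus_sym. apply Hle; lra.
    - apply Hle; lra. }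
  intros z s t Hz Hs Ht Hst. unfold closed_unit_disk in Hz.
  destruct (Rlt_dec (Cmod z) 1) as [Hz1|Hz1].
  { specialize (Hin z s t Hz1 Hs Ht Hst). lra. }
  assert (Hc : unit_circle z) by (unfold unit_circle; lra).
  destruct (angular_lim_approx (phi s) z (phi s z) Hc (Hextended s z Hs Hc)
    (eps / 3) ltac:(lra)) as (d1 & Hd1 & A1).
  destruct (angular_lim_approx (phi t) z (phi t z) Hc (Hextended t z Ht Hc)
    (eps / 3) ltac:(lra)) as (d2 & Hd2 & A2).
  set (x := Rmin (1 / 2) (Rmin (d1 / 2) (d2 / 2))).
  assert (Hx : 0 < x /\ x <= 1 / 2 /\ x <= d1 / 2 /\ x <= d2 / 2).
  { unfold x. pose proof (Rmin_l (1 / 2) (Rmin (d1 / 2) (d2 / 2))).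
    pose proof (Rmin_r (1 / 2) (Rmin (d1 / 2) (d2 / 2))).
    pose proof (Rmin_l (d1 / 2) (d2 / 2)). pose proof (Rmin_r (d1 / 2) (d2 / 2)).
    assert (0 < Rmin (1 / 2) (Rmin (d1 / 2) (d2 / 2)))
      by (repeat apply Rmin_pos; lra).
    lra. }
  specialize (A1 x ltac:(lra) ltac:(lra)). specialize (A2 x ltac:(lra) ltac:(lra)).
  set (y := (RtoC (1 - x) * z)%C) in *.
  assert (Hy : Cmod y < 1).
  { unfold y. rewrite Cmod_mult, Cmod_R, Hc, Rabs_pos_eq by lra. lra. }
  specialize (Hin y s t Hy Hs Ht Hst).
  pose proof (Cmod_minus_triangle (phi s z) (phi s y) (phi t z)) as T1.
  pose proof (Cmod_minus_triangle (phi s y) (phi t y) (phi t z)) as T2.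
  rewrite (Cmod_minus_sym (phi s z) (phi s y)) in T1. lra.
Qed.
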